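(* Let $\mathscr{D}$ be a dyadic grid in $\mathbb{R}^n$, let $\mathscr{S}\subset\mathscr{D}$ be a sparse family, let $0<\alpha<n$, $1<p<n/\alpha$, and let $q$ be defined by $\frac1q=\frac1p-\frac{\alpha}{n}$. With $p'=p/(p-1)$, assume that $\min\big(\frac{p'}{q},\frac{q}{p'}\big)\le 1-\frac{\alpha}{n}$, and let $w\in A_{p,q}$. Then the sparse fractional integral operator $$I_\alpha^{\mathscr{S}}f=\sum_{Q\in\mathscr{S}}|Q|^{\frac{\alpha}{n}}\Big(\frac{1}{|Q|}\int_Q f\,dx\Big)\chi_Q$$ satisfies $$\|I_\alpha^{\mathscr{S}}\|_{\mathscr{B}(L^p(w^p),L^q(w^q))}\le c_{p,\alpha}\,[w]_{A_{p,q}}^{(1-\frac{\alpha}{n})\max(1,\frac{p'}{q})},$$ where $$c_{p,\alpha}=p'\Big(1+\frac{q}{p'}\Big)^{1-\frac{\alpha}{n}}2^{(1-\frac{\alpha}{n})\max(\frac{q}{p'},\frac{p'}{q})}.$$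
   Context: Cubes have sides parallel to the coordinate axes, and $|E|$ denotes Lebesgue measure. A dyadic grid $\mathscr{D}$ is a collection of cubes in $\mathbb{R}^n$ such that: (i) each $Q\in\mathscr{D}$ satisfies $|Q|=2^{nk}$ for some $k\in\mathbb{Z}$; (ii) if $Q,P\in\mathscr{D}$ then $Q\cap P\in\{\varnothing,P,Q\}$; (iii) for each $k\in\mathbb{Z}$, the family $\{Q\in\mathscr{D}:|Q|=2^{nk}\}$ is a partition of $\mathbb{R}^n$. A family $\mathscr{S}\subset\mathscr{D}$ is sparse if for each $Q\in\mathscr{S}$, $$\Big|\bigcup_{Q'\in\mathscr{S},\,Q'\subsetneq Q}Q'\Big|\le\tfrac12|Q|.$$ A weight $w$ is a measurable function on $\mathbb{R}^n$ with $0<w<\infty$ a.e. For $p,q$ as in the statement, $w\in A_{p,q}$ means $$[w]_{A_{p,q}}:=\sup_Q\Big(\frac1{|Q|}\int_Q w^q\,dx\Big)\Big(\frac1{|Q|}\int_Q w^{-p'}\,dx\Big)^{\frac{q}{p'}}<\infty,$$ the supremum being over all cubes $Q\subset\mathbb{R}^n$. For a weight $v$, $L^p(v)$ is the space $L^p(\mathbb{R}^n,v\,dx)$, with $\|f\|_{L^p(v)}^p=\int_{\mathbb{R}^n}|f|^pv\,dx$, and $\|\cdot\|_{\mathscr{B}(X,Y)}$ denotes the operator norm from $X$ to $Y$. $\chi_Q$ is the characteristic function of $Q$. *)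

(* Defs.v *)
From HB Require Import structures.
From mathcomp Require Import all_boot all_order all_algebra.
From mathcomp Require Import all_classical all_reals all_analysis.
From mathcomp Require Import measurable_realfun.

Set Implicit Arguments.
Unset Strict Implicit.
Unset Printing Implicit Defensive.
Import Order.TTheory GRing.Theory Num.Theory.
Import numFieldNormedType.Exports.

Local Open Scope classical_set_scope.
Local Open Scope ring_scope.

Section cons_measure.
Local Open Scope ereal_scope.
Context d (T : measurableType d) (R : realType) (n : nat).
Variable m1 : {sigma_finite_measure set T -> \bar R}.
Variable mu : {sigma_finite_measure set (n.-tuple T) -> \bar R}.

Definition tuple_cons (x : T * n.-tuple T) : n.+1.-tuple T :=
  [the n.+1.-tuple T of x.1 :: x.2].

Lemma measurable_tuple_cons : measurable_fun [set: T * n.-tuple T] tuple_cons.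
Proof. exact: measurable_cons. Qed.

Definition cons_measure : set (n.+1.-tuple T) -> \bar R :=
  pushforward (m1 \x mu) tuple_cons.

Let cons_measure0 : cons_measure set0 = 0.
Proof. by rewrite /cons_measure /pushforward preimage_set0 measure0. Qed.

Let cons_measure_ge0 A : 0 <= cons_measure A.
Proof. by rewrite /cons_measure /pushforward; exact: measure_ge0. Qed.

Let cons_measure_sigma_additive : semi_sigma_additive cons_measure.
Proof.
move=> F mF tF mUF; rewrite /cons_measure /pushforward preimage_bigcup.
have mpre A : measurable A -> measurable (tuple_cons @^-1` A).
  by move=> mA; rewrite -[X in measurable X]setTI; exact: measurable_tuple_cons.
apply: measure_semi_sigma_additive.
- by move=> k; exact: mpre.
- apply/trivIsetP => /= i j _ _ ij; rewrite -preimage_setI.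
  by move/trivIsetP : tF => /(_ _ _ _ _ ij) ->//; rewrite preimage_set0.
- by rewrite -preimage_bigcup; exact: mpre.
Qed.

HB.instance Definition _ := isMeasure.Build _ _ _ cons_measure
  cons_measure0 cons_measure_ge0 cons_measure_sigma_additive.

Let cons_measure_sigma_finite : sigma_finite setT cons_measure.
Proof.
pose uncons (t : n.+1.-tuple T) : T * n.-tuple T :=
  (thead t, [tuple of behead t]).
have consK : cancel tuple_cons uncons.
  by move=> [a t]; rewrite /uncons theadE; congr pair; exact: val_inj.
have munc : measurable_fun setT uncons.
  apply: measurable_fun_pair; last exact: measurable_behead.
  exact: measurable_tnth.
have /sigma_finiteP[F [TF ndF Foo]] := sigma_finiteT m1.
have /sigma_finiteP[G [TG ndG Goo]] := sigma_finiteT mu.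
exists (fun k => uncons @^-1` (F k `*` G k)).
  rewrite -preimage_bigcup; apply/esym/seteqP; split=> // t _ /=.
  have [i _ Fi] : (\bigcup_k F k) (uncons t).1 by rewrite -TF.
  have [j _ Gj] : (\bigcup_k G k) (uncons t).2 by rewrite -TG.
  exists (maxn i j) => //; split.
    by move: Fi; exact/subsetPset/ndF/leq_maxl.
  by move: Gj; exact/subsetPset/ndG/leq_maxr.
move=> k; have [mF F_oo] := Foo k; have [mG G_oo] := Goo k; split.
  by rewrite -[X in measurable X]setTI; apply: munc => //; exact: measurableX.
rewrite /cons_measure /pushforward -comp_preimage.
have -> : (uncons \o tuple_cons) @^-1` (F k `*` G k) = F k `*` G k.
  rewrite (_ : uncons \o tuple_cons = id); last exact/funext.
  by rewrite preimage_id.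
by rewrite product_measure1E// lte_mul_pinfty// ge0_fin_numE.
Qed.

HB.instance Definition _ := @Measure_isSigmaFinite.Build _ _ _
  cons_measure cons_measure_sigma_finite.

End cons_measure.

Section lebesgue_measure_Rn.
Local Open Scope ereal_scope.
Context (R : realType).
Local Notation T := (measurableTypeR R).

(* The n-fold product of the Lebesgue measure on the Borel sets. *)
Fixpoint borel_lebesgue (n : nat) :
    {sigma_finite_measure set (n.-tuple T) -> \bar R} :=
  match n with
  | 0 => [the {sigma_finite_measure set (0.-tuple T) -> \bar R} of
           dirac ([tuple] : 0.-tuple T)]
  | m.+1 => [the {sigma_finite_measure set (m.+1.-tuple T) -> \bar R} of
              cons_measure (@lebesgue_measure R) (borel_lebesgue m)]
  end.

Lemma borel_lebesgue_box n (A : 'I_n -> set T) :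
  (forall i, measurable (A i)) ->
  measurable [set x : n.-tuple T | forall i, A i (tnth x i)] /\
  borel_lebesgue n [set x | forall i, A i (tnth x i)] =
    \prod_(i < n) lebesgue_measure (A i).
Proof.
elim: n A => [|n IH] A mA.
  have -> : [set x : 0.-tuple T | forall i, A i (tnth x i)] = setT.
    by apply/seteqP; split=> // x _ [].
  by split=> //; rewrite big_ord0 /= diracT.
have [mB HB] := IH (fun i => A (lift ord0 i)) (fun i => mA _).
have pre : @tuple_cons _ T n @^-1` [set x | forall i, A i (tnth x i)] =
    A ord0 `*` [set x | forall i, A (lift ord0 i) (tnth x i)].
  apply/seteqP; split=> [[a t] /= h|[a t] /= [h0 h] i].
    by split=> [|i]; [exact: (h ord0)|have := h (lift ord0 i); rewrite tnthS].
  by have [j ->|->//] := unliftP ord0 i; rewrite tnthS.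
split.
  rewrite (_ : [set x | _] =
      \bigcap_(i in [set: 'I_n.+1]) ((@tnth n.+1 T ^~ i) @^-1` A i)).
    apply: fin_bigcap_measurable => // i _; rewrite -[X in measurable X]setTI.
    exact: measurable_tnth.
  by apply/seteqP; split=> x /= h; [move=> i _; exact: h|move=> i; exact: h].
rewrite /= /cons_measure /pushforward pre product_measure1E//.
by rewrite big_ord_recl -HB.
Qed.

(* The points of R^n, equipped with the Lebesgue sigma-algebra, i.e., the
   Caratheodory-measurable sets (the completion of the Borel sets). *)
Definition Rn (n : nat) := caratheodory_type (borel_lebesgue n)^*%mu.
HB.instance Definition _ n := Measurable.on (Rn n).

Definition Rn_coord n (x : Rn n) (i : 'I_n) : R := tnth (x : n.-tuple T) i.

Definition lebesgue n : set (Rn n) -> \bar R :=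
  @completed_measure_extension _ _ _ (borel_lebesgue n).

HB.instance Definition _ n := Measure.on (@lebesgue n).

Let lebesgue_sigma_finite n : sigma_finite setT (@lebesgue n).
Proof.
exact/completed_measure_extension_sigma_finite/sigma_finiteT.
Qed.

HB.instance Definition _ n := @Measure_isSigmaFinite.Build _ _ _
  (@lebesgue n) (@lebesgue_sigma_finite n).

(* Cubes may contain any part of their boundary. *)
Definition is_cube n (Q : set (Rn n)) :=
  exists (a : 'I_n -> R) (l : R) (bl br : 'I_n -> bool), (0 < l)%R /\
    Q = [set x | forall i, Rn_coord x i \in
           Interval (BSide (bl i) (a i)) (BSide (br i) (a i + l)%R)].

Lemma lebesgue_cube n (a : 'I_n -> R) (l : R) (bl br : 'I_n -> bool)
    (Q := [set x : Rn n | forall i, Rn_coord x i \in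
             Interval (BSide (bl i) (a i)) (BSide (br i) (a i + l)%R)]) :
  (0 < l)%R -> measurable Q /\ lebesgue Q = (l ^+ n)%:E.
Proof.
move=> l0.
have [mB HB] := @borel_lebesgue_box n
  (fun i => [set` Interval (BSide (bl i) (a i)) (BSide (br i) (a i + l)%R)])
  (fun i => measurable_itv _).
split; first exact: caratheodory_measurable_mu_ext.
rewrite /lebesgue /completed_measure_extension.
transitivity (borel_lebesgue n Q); first exact: measurable_mu_extE.
rewrite [LHS]HB.
transitivity (\prod_(i < n) l%:E); last first.
  by rewrite prodEFin prodr_const card_ord.
apply: eq_bigr => i _.
rewrite lebesgue_measure_itv /= lte_fin ltrDl l0 -EFinB.
by rewrite addrAC subrr add0r.
Qed.

Definition is_dyadic_grid n (D : set (set (Rn n))) :=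
  [/\ (forall Q, D Q -> is_cube Q),
      (forall Q, D Q -> exists k : int, lebesgue Q = (2 ^ (n%:Z * k))%R%:E),
      (forall Q P, D Q -> D P -> [set set0; P; Q] (Q `&` P)) &
      (forall k : int,
         partition [set Q | D Q /\ lebesgue Q = (2 ^ (n%:Z * k))%R%:E]
                   id setT)].

Definition is_sparse n (S : set (set (Rn n))) :=
  forall Q, S Q ->
    lebesgue (\bigcup_(Q' in [set Q' | S Q' /\ Q' `<` Q]) Q')
      <= (2^-1)%:E * lebesgue Q.

Definition avg n (Q : set (Rn n)) (f : Rn n -> \bar R) : \bar R :=
  (fine (lebesgue Q))^-1%:E * \int[@lebesgue n]_(x in Q) f x.

Definition is_weight n (w : Rn n -> \bar R) :=
  measurable_fun [set: Rn n] w /\ {ae @lebesgue n, forall x, 0 < w x < +oo}.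

Definition conj_exp (p : R) : R := (p / (p - 1))%R.

Definition Apq_const n (p q : R) (w : Rn n -> \bar R) : \bar R :=
  ereal_sup [set avg Q (fun x => w x `^ q) *
                 avg Q (fun x => w x `^ (- conj_exp p)) `^ (q / conj_exp p)
            | Q in @is_cube n].

Definition is_Apq n (p q : R) (w : Rn n -> \bar R) :=
  is_weight w /\ Apq_const p q w < +oo.

Definition wnorm n (p : R) (v f : Rn n -> \bar R) : \bar R :=
  (\int[@lebesgue n]_x (`|f x| `^ p * v x)) `^ p^-1.

(* Elements of L^p(v dx) are represented by extended-real-valued measurable
   functions; a finite norm makes them finite wherever v > 0, almost
   everywhere. *)
Definition wLspace n (p : R) (v : Rn n -> \bar R) : set (Rn n -> \bar R) :=
  [set f | measurable_fun [set: Rn n] f /\ wnorm p v f < +oo].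

(* The norm of T : L^p(v) -> L^q(u) is the least C with
   |T f|_(L^q(u)) <= C |f|_(L^p(v)), and +oo if T does not map L^p(v) to
   L^q(u). *)
Definition op_norm n (p : R) (v : Rn n -> \bar R) (q : R) (u : Rn n -> \bar R)
    (T : (Rn n -> \bar R) -> (Rn n -> \bar R)) : \bar R :=
  ereal_inf [set C%:E | C in [set C : R | (0 <= C)%R /\
    forall f, wLspace p v f ->
      wLspace q u (T f) /\ wnorm q u (T f) <= C%:E * wnorm p v f]].

Definition sparse_term n (alpha : R) (f : Rn n -> \bar R) (x : Rn n)
    (Q : set (Rn n)) : \bar R :=
  lebesgue Q `^ (alpha / n%:R) * avg Q f * (\1_Q x)%:E.

(* Unconditional summation over the family S: the positive terms minus the
   negative terms. Where the series is not absolutely convergent, the value is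
   infinite (+oo - +oo = -oo), so that a finite L^q(w^q) norm entails absolute
   convergence almost everywhere. *)
Definition sparse_frac n (S : set (set (Rn n))) (alpha : R)
    (f : Rn n -> \bar R) (x : Rn n) : \bar R :=
  \esum_(Q in S) (sparse_term alpha f x)^\+ Q -
  \esum_(Q in S) (sparse_term alpha f x)^\- Q.

End lebesgue_measure_Rn.

(* Main.v *)
Require Import Defs.
From HB Require Import structures.
From mathcomp Require Import all_boot all_order all_algebra.
From mathcomp Require Import all_classical all_reals all_analysis.
From mathcomp Require Import measurable_realfun.
From mathcomp Require Import ring lra.

(* Put s = 1 - alpha/n = 1/q + 1/p', u = w^q, sigma = w^(-p'). Writing
   f = phi sigma and testing I_alpha^S f against g u, one has to bound
   sum_Q |Q|^(-s) (int_Q phi sigma) (int_Q g u). Assume p'/q <= s; the other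
   case follows by exchanging the roles of (sigma, p') and (u, q).
   Hoelder's inequality gives
   int_Q g u <= (u(Q) <g^r>_Q^u)^s (int g^q' u)^(1-s), where r = q'/(p' s).
   The A_{p,q} condition, raised to the power s, bounds |Q|^(-s) sigma(Q) u(Q)^s
   by [w]^s |Q|^k sigma(Q)^(1-k), with k = s q/p' >= 1. By sparseness, |Q| and
   sigma(Q) may be replaced here by 2|E_Q| and sigma(E_Q), where the sets
   E_Q = Q minus the smaller cubes of S are disjoint, and
   |E_Q| <= u(E_Q)^(p'/(p'+q)) sigma(E_Q)^(q/(p'+q)). The exponents are such that
   Hoelder's inequality for sums reduces the claim to Doob's inequality
   sum_Q (<h>_Q^rho)^t rho(E_Q) <= t'^t int h^t rho, used with (phi, sigma, p)
   and with (g^r, u, p' s). Taking g = (I f)^(q-1) for finite subfamilies, whose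
   norm is finite a priori, and letting the subfamily grow gives the theorem. *)

Import Order.TTheory GRing.Theory Num.Theory.
Import numFieldNormedType.Exports.

Local Open Scope classical_set_scope.
Local Open Scope ring_scope.

Set Implicit Arguments.
Unset Strict Implicit.
Unset Printing Implicit Defensive.

(** * Interpolation form of Hoelder's inequality *)

(** The bound on the minimum gives k >= 1, and this decides the passage from Q to E_Q: sigma(Q)
    carries the exponent 1 - k, so replacing it by the smaller sigma(E_Q) is allowed only when 1 - k
    <= 0. The constant can be read off the steps. The factor p' is Doob's constant for phi at the
    exponent p. The factor 1 + q/p' is Doob's constant for g^r at the exponent p' s; that sum enters
    with the power 1/p', which leaves the power s. The factor 2^k pays for |Q| <= 2|E_Q|. Exchanging
    the roles turns the bound W of the A_{p,q} condition into W^(p'/q) and k into s p'/q, whence the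
    two maxima. Doob's inequality is needed for finite nested families only, and is obtained by
    attaching one minimal cube at a time, without a filtration. Its proof and the final choice of g
    both end in N <= K N^(1 - 1/t), where N can be cancelled only if it is finite; this obstacle
    forces the detour through finite subfamilies. *)

Lemma powR_mul_compl (R : realType) (x t : R) : 0 <= x -> x `^ t * x `^ (1 - t) = x.
Proof.
have t1 : t + (1 - t) = 1 by rewrite addrC subrK.
by move=> x0; rewrite -powRD ?t1 ?powRr1// oner_eq0.
Qed.

Lemma mulr_powR_pred (R : realType) (x t : R) : 0 <= x -> 0 < t ->
  x * x `^ (t - 1) = x `^ t.
Proof.
move=> x0 t0; have tE : 1 + (t - 1) = t by rewrite addrC subrK.
by rewrite -{1}(powRr1 x0) -powRD tE// gt_eqF.
Qed.

Lemma ler_powR_absorb (R : realType) (t N K : R) : 0 < t -> 0 <= N -> 0 <= K ->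
  N <= K * N `^ (1 - t^-1) -> N <= K `^ t.
Proof.
move=> t0 N0 K0 NK; have ti : t^-1 * t = 1 by rewrite mulVf// gt_eqF.
move: N0; rewrite le_eqVlt => /predU1P[<-|N0]; first exact: powR_ge0.
have NS : N `^ t^-1 * N `^ (1 - t^-1) = N by apply: powR_mul_compl; exact: ltW.
have NtK : N `^ t^-1 <= K by rewrite -(ler_pM2r (powR_gt0 (1 - t^-1) N0)) NS.
have -> : N = (N `^ t^-1) `^ t by rewrite -powRrM ti powRr1// ltW.
by apply: ge0_ler_powR; rewrite ?nnegrE ?powR_ge0 ?(ltW t0).
Qed.

Section interpolation.
Context d (T : measurableType d) (R : realType).
Variable mu : {measure set T -> \bar R}.
Implicit Types (D : set T) (k : T -> R).

Lemma integral_restrict_indic D k :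
  (\int[mu]_(x in D) (k x)%:E = \int[mu]_x (k x * \1_D x)%:E)%E.
Proof.
rewrite integral_mkcond; apply: eq_integral => x _.
by rewrite patchE indicE; case: ifP; rewrite /= ?mulr1 ?mulr0.
Qed.

Lemma measurable_powR_comp k (t : R) :
  measurable_fun setT k -> measurable_fun setT (fun x => k x `^ t).
Proof. by move=> mk; exact: (measurableT_comp (measurable_powR t) mk). Qed.

(** Hoelder's inequality with the exponents 1/t and 1/(1 - t), written with powers of integrals
    instead of norms: a factorisation of the integrand then becomes the same factorisation of the
    integrals. No finiteness is assumed. *)
Lemma integral_interpolation D k1 k2 (t : R) : measurable D ->
  measurable_fun setT k1 -> measurable_fun setT k2 ->
  (forall x, 0 <= k1 x) -> (forall x, 0 <= k2 x) -> 0 < t -> t < 1 ->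
  (\int[mu]_(x in D) (k1 x `^ t * k2 x `^ (1 - t))%:E <=
   (\int[mu]_(x in D) (k1 x)%:E) `^ t *
   (\int[mu]_(x in D) (k2 x)%:E) `^ (1 - t))%E.
Proof.
move=> mD mk1 mk2 k10 k20 t0 t1; have t1' : 0 < 1 - t by rewrite subr_gt0.
have mi : measurable_fun setT (\1_D : T -> R) by exact: measurable_indic.
have mp k r : measurable_fun setT k ->
    measurable_fun setT (fun x => k x `^ r * \1_D x).
  by move=> mk; apply: measurable_funM => //; exact: measurable_powR_comp.
have := @hoelder _ _ _ mu (fun x => k1 x `^ t * \1_D x)
  (fun x => k2 x `^ (1 - t) * \1_D x) t^-1 (1 - t)^-1 (mp _ _ mk1) (mp _ _ mk2).
have t11 : t + (1 - t) = 1 by rewrite addrC subrK.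
rewrite !invr_gt0 !invrK => /(_ t0 t1' t11).
rewrite Lnorm1 !unlock !invrK.
have E k r : 0 < r -> (forall x, 0 <= k x) ->
    (\int[mu]_x `|(EFin \o (fun x => (k x `^ r * \1_D x)%R)) x| `^ r^-1 =
     \int[mu]_(x in D) (k x)%:E)%E.
  move=> r0 k0; rewrite integral_restrict_indic; apply: eq_integral => x _.
  rewrite /= ger0_norm ?mulr_ge0 ?powR_ge0// powRM ?powR_ge0//.
  rewrite -powRrM divff ?gt_eqF// powRr1// indicE; case: (x \in D) => /=.
    by rewrite powR1.
  by rewrite powR0 ?invr_eq0 ?gt_eqF.
rewrite [X in (_ <= X `^ _ * _)%E](E k1 t)// [X in (_ <= _ * X `^ _)%E](E k2)//.
apply: le_trans.
rewrite integral_restrict_indic.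
rewrite le_eqVlt; apply/orP; left; apply/eqP/eq_integral => x _ /=.
rewrite ger0_norm ?mulr_ge0 ?powR_ge0//.
by rewrite indicE; case: (x \in D) => /=; rewrite ?mulr1 ?mulr0.
Qed.

Lemma emeasurable_sum_in (I : eqType) (r : seq I) (f : I -> T -> \bar R) :
  (forall i, i \in r -> measurable_fun setT (f i)) ->
  measurable_fun setT (fun x => \sum_(i <- r) f i x)%E.
Proof.
move=> mf; pose h i := if i \in r then f i else cst 0%E.
rewrite (_ : (fun x => _) = fun x => (\sum_(i <- r) h i x)%E); last first.
  apply/funext => x; rewrite big_seq [RHS]big_seq.
  by apply: eq_bigr => i ir; rewrite /h ir.
apply: emeasurable_sum => i; rewrite /h.
by case: (boolP (i \in r)) => [/mf//|_]; exact: measurable_cst.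
Qed.

Lemma ge0_integral_sum_in (I : eqType) (r : seq I) (f : I -> T -> \bar R) :
  (forall i, i \in r -> measurable_fun setT (f i)) ->
  (forall i x, i \in r -> (0 <= f i x)%E) ->
  (\int[mu]_x (\sum_(i <- r) f i x) = \sum_(i <- r) \int[mu]_x f i x)%E.
Proof.
elim: r => [|i r IH] mf f0.
  under eq_integral do rewrite big_nil.
  by rewrite integral0 big_nil.
have mr j : j \in r -> measurable_fun setT (f j).
  by move=> jr; apply: mf; rewrite inE jr orbT.
have r0 j x : j \in r -> (0 <= f j x)%E.
  by move=> jr; apply: f0; rewrite inE jr orbT.
under eq_integral do rewrite big_cons.
rewrite big_cons ge0_integralD//.
- by rewrite IH.
- by move=> x _; apply: f0; rewrite mem_head.
- by apply: mf; rewrite mem_head.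
- by move=> x _; rewrite big_seq; apply: sume_ge0 => j; exact: r0.
- exact: emeasurable_sum_in.
Qed.

End interpolation.

(** * The dyadic maximal function *)

(** Every set strictly containing a given nonempty member comes later in the list. Induction on the
    list therefore attaches a set only after all larger ones, when it is minimal. *)
Fixpoint leaf_first (T : Type) (F : seq (set T)) : Prop :=
  if F is Q :: F' then
    (forall Q', Q' \in F' -> Q `<=` Q' \/ Q `&` Q' = set0) /\ leaf_first F'
  else True.

Section maximal.
Context d (T : measurableType d) (R : realType).
Variable mu : {measure set T -> \bar R}.
Implicit Types (Q : set T) (F : seq (set T)) (a : set T -> R).

Definition max_indic a F (x : T) : R := \big[Num.max/0]_(Q <- F) (a Q * \1_Q x).

Lemma max_indic_cons a Q F x :
  max_indic a (Q :: F) x = Num.max (a Q * \1_Q x) (max_indic a F x).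
Proof. by rewrite /max_indic big_cons. Qed.

Lemma max_indic_ge0 a F x : 0 <= max_indic a F x.
Proof.
elim: F => [|Q F IH]; first by rewrite /max_indic big_nil.
by rewrite max_indic_cons le_max IH orbT.
Qed.

Lemma le_max_indic a F Q x : Q \in F -> Q x -> a Q <= max_indic a F x.
Proof.
elim: F => [//|P F IH]; rewrite inE max_indic_cons le_max => /orP[/eqP ->|QF] Qx.
  by rewrite indicE mem_set// mulr1 lexx.
by rewrite IH ?orbT.
Qed.

Lemma measurable_max_indic a F : (forall Q, Q \in F -> measurable Q) ->
  measurable_fun setT (max_indic a F).
Proof.
elim: F => [|Q F IH] mF.
  rewrite (_ : max_indic a [::] = cst 0)//.
  by apply/funext => x; rewrite /max_indic big_nil.
rewrite (_ : max_indic a _ =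
    (fun x => Num.max (a Q * \1_Q x) (max_indic a F x))); last first.
  by apply/funext => x; rewrite max_indic_cons.
apply: measurable_maxr.
  apply: measurable_funM => //; apply: measurable_indic.
  by apply: mF; rewrite mem_head.
by apply: IH => P PF; apply: mF; rewrite inE PF orbT.
Qed.

(* Every cube of [F] contains [Q] or misses it, so the maximal function of [F]
   is constant on [Q]. *)
Lemma max_indic_leaf a Q F : (forall P, P \in F -> 0 <= a P) ->
  (forall Q', Q' \in F -> Q `<=` Q' \/ Q `&` Q' = set0) ->
  exists2 L, 0 <= L & forall x, Q x -> max_indic a F x = L.
Proof.
elim: F => [|P F IH] a0 nest.
  by exists 0 => // x _; rewrite /max_indic big_nil.
have [||L L0 HL] := IH.
- by move=> P' P'F; apply: a0; rewrite inE P'F orbT.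
- by move=> P' P'F; apply: nest; rewrite inE P'F orbT.
have [QP|QP] := nest P (mem_head _ _).
- exists (Num.max (a P) L); first by rewrite le_max L0 orbT.
  move=> x Qx; rewrite max_indic_cons HL// indicE mem_set ?mulr1//.
  exact: QP.
- exists L => // x Qx; rewrite max_indic_cons HL// indicE memNset ?mulr0.
    by rewrite max_r.
  by move=> Px; have : (Q `&` P) x by []; rewrite QP.
Qed.

(** Attaching a minimal cube changes a power of the maximal function by a constant on that cube. The
    same [L] serves all exponents [r], because the increments for [t] and [t - 1] have to be
    compared. *)
Lemma max_indic_powR_leaf a Q F : 0 <= a Q -> (forall P, P \in F -> 0 <= a P) ->
  (forall Q', Q' \in F -> Q `<=` Q' \/ Q `&` Q' = set0) ->
  exists2 L, 0 <= L <= Num.max (a Q) L & forall r x,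
    max_indic a (Q :: F) x `^ r =
    max_indic a F x `^ r + (Num.max (a Q) L `^ r - L `^ r) * \1_Q x.
Proof.
move=> aQ a0 nest; have [L L0 HL] := max_indic_leaf a0 nest.
exists L; first by rewrite L0 le_max lexx orbT.
move=> r x; rewrite max_indic_cons indicE.
have [/set_mem Qx|Qx] := boolP (x \in Q).
  by rewrite HL// !mulr1 addrC subrK.
by rewrite !mulr0 addr0 max_r// max_indic_ge0.
Qed.

Lemma integral_addindic (k rho : T -> R) Q (c : R) :
  measurable_fun setT k -> measurable_fun setT rho -> measurable Q ->
  (forall x, 0 <= k x) -> (forall x, 0 <= rho x) -> 0 <= c ->
  (\int[mu]_x ((k x + c * \1_Q x) * rho x)%:E =
   \int[mu]_x (k x * rho x)%:E + c%:E * \int[mu]_(x in Q) (rho x)%:E)%E.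
Proof.
move=> mk mr mQ k0 r0 c0.
have mi : measurable_fun setT (\1_Q : T -> R) by exact: measurable_indic.
under eq_integral do rewrite mulrDl EFinD -mulrA (EFinM c).
have mir : measurable_fun setT (EFin \o (fun x => \1_Q x * rho x)).
  by apply/measurable_EFinP; exact: measurable_funM.
have i0 x : (0 <= (\1_Q x * rho x)%:E)%E by rewrite lee_fin mulr_ge0.
rewrite ge0_integralD//.
- rewrite [X in (_ + X)%E](@ge0_integralZl_EFin _ _ _ mu setT)//.
  rewrite integral_restrict_indic; do 2 f_equal.
  by apply: eq_integral => x _; rewrite mulrC.
- by move=> x _; rewrite lee_fin mulr_ge0.
- by apply/measurable_EFinP; exact: measurable_funM.
- by move=> x _; rewrite mule_ge0 ?lee_fin ?mulr_ge0.
- apply: measurable_funeM; exact: mir.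
Qed.

(** Young's inequality for the product of [b] and L^(t-1). It is a discrete form of d(M^t) = t' M
    d(M^(t-1)), with t' = t/(t-1), and is the source of Doob's constant. *)
Lemma subr_powR_young (t L b : R) : 1 < t -> 0 <= L -> 0 <= b ->
  b `^ t - L `^ t <= t / (t - 1) * ((b `^ (t - 1) - L `^ (t - 1)) * b).
Proof.
move=> t1 L0 b0; have tp : 0 < t by rewrite (lt_trans _ t1).
have t1p : 0 < t - 1 by rewrite subr_gt0.
have t0 : t != 0 by rewrite gt_eqF.
have t10 : t - 1 != 0 by rewrite gt_eqF.
have := @conjugate_powR R b (L `^ (t - 1)) t (t / (t - 1)) b0 (powR_ge0 _ _) tp.
rewrite divr_gt0// => /(_ isT).
have -> : t^-1 + (t / (t - 1))^-1 = 1 by field; apply/andP.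
move=> /(_ erefl); rewrite -powRrM.
have -> : (t - 1) * (t / (t - 1)) = t by field.
move=> Y.
have bt : b `^ (t - 1) * b = b `^ t.
  by rewrite mulrC mulr_powR_pred.
rewrite mulrBl bt -ler_pdivrMl ?divr_gt0// (mulrC _ b).
set X := b `^ t in Y *; set Z := L `^ t in Y *; set W := b * _ in Y *.
have : X - W >= X - (X / t + Z / (t / (t - 1))) by rewrite lerD2l lerN2.
apply: le_trans; rewrite le_eqVlt; apply/orP; left; apply/eqP; field.
exact/andP.
Qed.

End maximal.

(** * Doob's inequality for finite nested families *)

Section doob.
Context d (T : measurableType d) (R : realType).
Variable mu : {measure set T -> \bar R}.
Variables (h rho : T -> R) (t : R) (a : set T -> R).
Hypotheses (mh : measurable_fun setT h) (mrho : measurable_fun setT rho).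
Hypotheses (h0 : forall x, 0 <= h x) (rho0 : forall x, 0 <= rho x).
Hypothesis t1 : 1 < t.
Implicit Types (Q : set T) (F : seq (set T)).

(** The average of [h] with respect to rho dmu, multiplied out so that no division by rho(Q) occurs.
    As rho(Q) is finite, the integral of h rho over Q is finite as well. *)
Definition is_average Q := [/\ measurable Q, 0 <= a Q,
  (\int[mu]_(x in Q) (rho x)%:E < +oo)%E &
  ((a Q)%:E * \int[mu]_(x in Q) (rho x)%:E =
   \int[mu]_(x in Q) (h x * rho x)%:E)%E].

(** Attaching Q raises the two integrals by the increments of M^t and M^(t-1) on Q, times rho(Q) and
    times the integral of h rho over Q, which is [a Q] times rho(Q). The claim thus reduces to an
    inequality between numbers. Finiteness travels along in the induction, since the absorption in
    [doob_max] depends on it. *)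
Lemma doob_weak F : leaf_first F -> (forall Q, Q \in F -> is_average Q) ->
  (\int[mu]_x (max_indic a F x `^ t * rho x)%:E < +oo)%E /\
  (\int[mu]_x (max_indic a F x `^ t * rho x)%:E <= (t / (t - 1))%:E *
    \int[mu]_x (max_indic a F x `^ (t - 1) * (h x * rho x))%:E)%E.
Proof.
have t1p : 0 < t - 1 by rewrite subr_gt0.
have tp : 0 < t by rewrite (lt_trans _ t1).
elim: F => [_ _|Q F IH [nest lf] av].
  have E (r : R) (k : T -> R) : 0 < r ->
      (\int[mu]_x (max_indic a [::] x `^ r * k x)%:E = 0)%E.
    move=> r0; apply: integral0_eq => x _.
    by rewrite /max_indic big_nil powR0 ?gt_eqF// mul0r.
  by rewrite E// E// mule0.
have avF P : P \in F -> is_average P by move=> PF; apply: av; rewrite inE PF orbT.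
have {IH} [fin IH] := IH lf avF.
have [mQ aQ Qfin aE] := av Q (mem_head _ _).
have aF P : P \in F -> 0 <= a P by move=> /avF[].
have [L /andP[L0 LM] ME] := max_indic_powR_leaf aQ aF nest.
have mM (r : R) : measurable_fun setT (fun x => max_indic a F x `^ r).
  apply: measurable_powR_comp; apply: measurable_max_indic => P /avF[]//.
have step (r : R) (k : T -> R) : 0 < r -> measurable_fun setT k -> (forall x, 0 <= k x) ->
    (\int[mu]_x (max_indic a (Q :: F) x `^ r * k x)%:E =
     \int[mu]_x (max_indic a F x `^ r * k x)%:E +
     (Num.max (a Q) L `^ r - L `^ r)%:E * \int[mu]_(x in Q) (k x)%:E)%E.
  move=> r0 mk k0; under eq_integral do rewrite ME.
  rewrite integral_addindic// => [x|]; first exact: powR_ge0.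
  rewrite subr_ge0; apply: ge0_ler_powR; rewrite ?nnegrE//; first exact: ltW.
  by rewrite le_max aQ.
have mhr : measurable_fun setT (fun x => h x * rho x) by exact: measurable_funM.
have hr0 x : 0 <= h x * rho x by rewrite mulr_ge0.
rewrite (step t rho tp mrho rho0).
have /= -> := step (t - 1) (fun x => h x * rho x) t1p mhr hr0.
have S0 : (0 <= \int[mu]_(x in Q) (rho x)%:E)%E.
  by apply: integral_ge0 => x _; rewrite lee_fin.
have Mge (r : R) : 0 <= r -> 0 <= Num.max (a Q) L `^ r - L `^ r.
  move=> r0; rewrite subr_ge0; apply: ge0_ler_powR; rewrite ?nnegrE//.
  by rewrite le_max aQ.
split.
  by rewrite lte_add_pinfty// lte_mul_pinfty// lee_fin (Mge t (ltW tp)).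
have I0 : (0 <= \int[mu]_x (max_indic a F x `^ (t - 1) * (h x * rho x))%:E)%E.
  by apply: integral_ge0 => x _; rewrite lee_fin mulr_ge0 ?powR_ge0.
have J0 : (0 <= (Num.max (a Q) L `^ (t - 1) - L `^ (t - 1))%:E *
                \int[mu]_(x in Q) (h x * rho x)%:E)%E.
  apply: mule_ge0; first by rewrite lee_fin; exact: Mge (ltW t1p).
  by apply: integral_ge0 => x _; rewrite lee_fin.
rewrite [X in (_ <= X)%E]ge0_muleDr//.
apply: leeD => //; rewrite -aE !muleA -!EFinM; apply: lee_wpmul2r => //.
rewrite lee_fin -mulrA.
(* An average not exceeding the old maximum changes neither side; otherwise the new maximum is [a Q]
   itself, and Young's inequality applies. *)
have [aL|La] := leP (a Q) L; first by rewrite !subrr mul0r mulr0.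
exact: subr_powR_young.
Qed.

(** The integrand M^(t-1) h rho factors as (h^t rho)^(1/t) (M^t rho)^(1 - 1/t); Hoelder's inequality
    then bounds the right side of [doob_weak], and the power of the integral of M^t rho is
    absorbed. *)
Lemma doob_max F : leaf_first F -> (forall Q, Q \in F -> is_average Q) ->
  (\int[mu]_x (h x `^ t * rho x)%:E < +oo)%E ->
  (\int[mu]_x (max_indic a F x `^ t * rho x)%:E <=
   ((t / (t - 1)) `^ t)%:E * \int[mu]_x (h x `^ t * rho x)%:E)%E.
Proof.
move=> lf av hfin; have [Mfin Mle] := doob_weak lf av.
have tp : 0 < t by rewrite (lt_trans _ t1).
have t0 : t != 0 by rewrite gt_eqF.
have t1p : 0 < t - 1 by rewrite subr_gt0.
have ti : 0 < t^-1 by rewrite invr_gt0.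
have ti1 : t^-1 < 1 by rewrite invf_lt1.
have mM : measurable_fun setT (max_indic a F).
  by apply: measurable_max_indic => P /av[].
have m1 : measurable_fun setT (fun x => h x `^ t * rho x).
  by apply: measurable_funM => //; exact: measurable_powR_comp.
have m2 : measurable_fun setT (fun x => max_indic a F x `^ t * rho x).
  by apply: measurable_funM => //; exact: measurable_powR_comp.
have p1 x : 0 <= h x `^ t * rho x by rewrite mulr_ge0 ?powR_ge0.
have p2 x : 0 <= max_indic a F x `^ t * rho x by rewrite mulr_ge0 ?powR_ge0.
have := @integral_interpolation _ _ _ mu setT _ _ t^-1 measurableT m1 m2 p1 p2
  ti ti1.
have E x : ((h x `^ t * rho x) `^ t^-1 *
    (max_indic a F x `^ t * rho x) `^ (1 - t^-1)) =
    max_indic a F x `^ (t - 1) * (h x * rho x).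
  rewrite !powRM ?powR_ge0// -!powRrM mulfV// powRr1//.
  have -> : t * (1 - t^-1) = t - 1 by rewrite mulrBr mulr1 mulfV.
  rewrite mulrACA -powRD ?[t^-1 + _]addrC ?subrK ?powRr1 ?oner_eq0//.
  by ring.
under eq_integral do rewrite E.
have H0 : (0 <= \int[mu]_x (h x `^ t * rho x)%:E)%E.
  by apply: integral_ge0 => x _; rewrite lee_fin.
have M0 : (0 <= \int[mu]_x (max_indic a F x `^ t * rho x)%:E)%E.
  by apply: integral_ge0 => x _; rewrite lee_fin.
move: H0 M0 hfin Mfin Mle.
case: (\int[mu]_x (h x `^ t * rho x)%:E)%E => // H.
case: (\int[mu]_x (max_indic a F x `^ t * rho x)%:E)%E => // X.
rewrite !lee_fin !poweR_EFin => H0 X0 _ _ X1 hol.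
have c0 : 0 < t / (t - 1) by rewrite divr_gt0.
have : (X%:E <= (t / (t - 1))%:E * ((H `^ t^-1)%:E * (X `^ (1 - t^-1))%:E))%E.
  by apply: le_trans X1 _; apply: lee_wpmul2l; [rewrite lee_fin ltW | exact: hol].
rewrite -!EFinM !lee_fin mulrA => {}X1.
have H1 : 0 <= t / (t - 1) * H `^ t^-1 by rewrite mulr_ge0 ?powR_ge0 ?ltW.
have := ler_powR_absorb tp X0 H1 X1.
by rewrite (powRM _ (ltW c0) (powR_ge0 _ _)) -powRrM mulVf// powRr1.
Qed.

(** By disjointness at most one summand is nonzero at [x], and its coefficient is one of those over
    which the maximum is taken. *)
Lemma sum_indic_le_max (E : set T -> set T) F x : uniq F ->
  (forall Q, Q \in F -> 0 <= a Q) ->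
  (forall Q, Q \in F -> E Q `<=` Q) ->
  (forall Q P, Q \in F -> P \in F -> Q != P -> E Q `&` E P = set0) ->
  \sum_(Q <- F) a Q `^ t * \1_(E Q) x <= max_indic a F x `^ t.
Proof.
move=> uF a0 EQ Edisj; have tp : 0 < t by rewrite (lt_trans _ t1).
have [[Q QF EQx]|no] := pselect (exists2 Q, Q \in F & E Q x); last first.
  rewrite big_seq big1 ?powR_ge0// => Q QF; rewrite indicE memNset ?mulr0//.
  by move=> EQx; apply: no; exists Q.
rewrite (bigD1_seq Q)//= big_seq_cond big1 ?addr0; last first.
  move=> P /andP[PF PQ]; rewrite indicE memNset ?mulr0// => EPx.
  by have : (E P `&` E Q) x by []; rewrite Edisj.
rewrite indicE mem_set// mulr1.
have QM : a Q <= max_indic a F x by apply: le_max_indic => //; exact: EQ.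
by apply: ge0_ler_powR; rewrite ?nnegrE ?max_indic_ge0 ?a0 ?(ltW tp).
Qed.

(** A Carleson embedding: the pointwise bound of [sum_indic_le_max] is integrated against rho, and
    [doob_max] concludes. *)
Lemma doob_sparse (E : set T -> set T) F : uniq F -> leaf_first F ->
  (forall Q, Q \in F -> is_average Q) ->
  (forall Q, Q \in F -> measurable (E Q) /\ E Q `<=` Q) ->
  (forall Q P, Q \in F -> P \in F -> Q != P -> E Q `&` E P = set0) ->
  (\int[mu]_x (h x `^ t * rho x)%:E < +oo)%E ->
  (\sum_(Q <- F) (a Q `^ t)%:E * \int[mu]_(x in E Q) (rho x)%:E <=
   ((t / (t - 1)) `^ t)%:E * \int[mu]_x (h x `^ t * rho x)%:E)%E.
Proof.
move=> uF lf av EQ Edisj hfin; apply: le_trans (doob_max lf av hfin).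
have mM : measurable_fun setT (max_indic a F).
  by apply: measurable_max_indic => P /av[].
have mr Q : Q \in F -> measurable_fun setT (fun x => rho x * \1_(E Q) x).
  move=> /EQ[mE _]; apply: measurable_funM => //; exact: measurable_indic.
pose g Q x := (a Q `^ t * (rho x * \1_(E Q) x))%:E.
have gE : (\sum_(Q <- F) (a Q `^ t)%:E * \int[mu]_(x in E Q) (rho x)%:E =
    \sum_(Q <- F) \int[mu]_x g Q x)%E.
  rewrite big_seq [RHS]big_seq; apply: eq_bigr => Q QF.
  rewrite integral_restrict_indic -ge0_integralZl_EFin ?powR_ge0//.
  - by move=> x _; rewrite lee_fin mulr_ge0.
  - by apply/measurable_EFinP; exact: mr.
have mg Q : Q \in F -> measurable_fun setT (g Q).
  by move=> QF; apply/measurable_EFinP; apply: measurable_funM => //; exact: mr.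
have g0 Q x : Q \in F -> (0 <= g Q x)%E.
  by move=> _; rewrite lee_fin !mulr_ge0 ?powR_ge0.
rewrite gE -ge0_integral_sum_in//; apply: ge0_le_integral => //.
- by move=> x _; rewrite big_seq; apply: sume_ge0 => Q; exact: g0.
- exact: emeasurable_sum_in.
- apply/measurable_EFinP; apply: measurable_funM => //.
  exact: measurable_powR_comp.
- move=> x _; rewrite sumEFin lee_fin.
  under eq_bigr do rewrite mulrA mulrAC.
  rewrite -mulr_suml ler_wpM2r// sum_indic_le_max// => Q.
    by case/av.
  by case/EQ.
Qed.

End doob.

(** * Inequalities for finite sums and for a single cube *)

Section sums.
Context (R : realType).

Lemma sum_interpolation (I : Type) (F : seq I) (x y : I -> R) (t : R) :
  (forall i, 0 <= x i) -> (forall i, 0 <= y i) -> 0 < t -> t < 1 ->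
  \sum_(i <- F) x i `^ t * y i `^ (1 - t) <=
  (\sum_(i <- F) x i) `^ t * (\sum_(i <- F) y i) `^ (1 - t).
Proof.
move=> x0 y0 t0 t1; have t1' : 0 < 1 - t by rewrite subr_gt0.
have tt : t + (1 - t) = 1 by rewrite addrC subrK.
elim: F => [|i F IH]; first by rewrite !big_nil mulr_ge0 ?powR_ge0.
rewrite !big_cons; apply: le_trans (lerD (lexx _) IH) _.
have sx : 0 <= \sum_(j <- F) x j by apply: sumr_ge0.
have sy : 0 <= \sum_(j <- F) y j by apply: sumr_ge0.
have K (z r : R) : 0 <= z -> 0 < r -> (z `^ r) `^ r^-1 = z.
  by move=> z0 r0; rewrite -powRrM mulfV ?gt_eqF// powRr1.
have := @hoelder2 R (x i `^ t) ((\sum_(j <- F) x j) `^ t)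
  (y i `^ (1 - t)) ((\sum_(j <- F) y j) `^ (1 - t)) t^-1 (1 - t)^-1
  (powR_ge0 _ _) (powR_ge0 _ _) (powR_ge0 _ _) (powR_ge0 _ _).
by rewrite !invr_gt0 !invrK !K//; exact.
Qed.

(** The numbers stand for m = |Q|, e = |E_Q|, S = sigma(Q), U = u(Q), SE = sigma(E_Q) and UE =
    u(E_Q); (a, b) is (p', q) or (q, p'). All relations are between monomials, so after taking
    logarithms the claim is a linear combination: s times the Muckenhoupt condition, k times the
    bound for [m], and k - 1 times the comparison of [SE] with [S], where k = s b / a. *)
Lemma sparse_term_bound (a b s m e S U SE UE W : R) :
  1 < a -> 1 < b -> s = a^-1 + b^-1 -> 1 <= s * b / a ->
  0 < m -> m <= 2 * e -> 0 <= SE -> 0 <= UE -> SE <= S -> UE <= U ->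
  e <= UE `^ (b^-1 / s) * SE `^ (1 - b^-1 / s) ->
  U / m * (S / m) `^ (b / a) <= W ->
  m `^ (- s) * S * U `^ s <=
  2 `^ (s * b / a) * W `^ s * (SE `^ (1 - a^-1) * UE `^ a^-1).
Proof.
move=> a1 b1 sE k1 m0 me SE0 UE0 SES UEU eE UW.
have a0 : 0 < a by rewrite (lt_trans _ a1).
have b0 : 0 < b by rewrite (lt_trans _ b1).
have s0 : 0 < s by rewrite sE addr_gt0 ?invr_gt0.
have e0 : 0 < e by rewrite -(@pmulr_rgt0 _ 2)// (lt_le_trans m0).
have ab0 : 0 < a + b by exact: addr_gt0.
have th0 : b^-1 / s != 0 by rewrite mulf_neq0 ?invr_eq0 ?gt_eqF.
have th1 : 1 - b^-1 / s != 0.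
  rewrite (_ : 1 - b^-1 / s = a^-1 / s).
    by rewrite mulf_neq0 ?invr_eq0 ?gt_eqF.
  by rewrite sE; field; rewrite !gt_eqF ?addr_gt0.
(* Logarithms need positive arguments. Both exponents in the bound for [e] are nonzero, so a
   vanishing [UE] or [SE] would contradict [0 < e]. *)
have UEp : 0 < UE.
  rewrite lt_neqAle UE0 andbT eq_sym; apply: contraTneq (lt_le_trans e0 eE) => ->.
  by rewrite powR0// mul0r ltxx.
have SEp : 0 < SE.
  rewrite lt_neqAle SE0 andbT eq_sym; apply: contraTneq (lt_le_trans e0 eE) => ->.
  by rewrite (powR0 th1)// mulr0 ltxx.
have Sp : 0 < S by exact: lt_le_trans SES.
have Up : 0 < U by exact: lt_le_trans UEU.
have P0 : 0 < U / m * (S / m) `^ (b / a).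
  by rewrite mulr_gt0 ?powR_gt0 ?divr_gt0.
have Wp : 0 < W by exact: lt_le_trans UW.
have lnle (x y : R) : 0 < x -> x <= y -> ln x <= ln y.
  by move=> x0 xy; rewrite ler_ln ?posrE// (lt_le_trans x0).
have {}me := lnle _ _ m0 me; have {}eE := lnle _ _ e0 eE.
have {}UW := lnle _ _ P0 UW; have {}SES := lnle _ _ SEp SES.
have l2 : 0 < (2 : R) by [].
move: me eE UW.
rewrite !lnM ?posrE ?mulr_gt0 ?powR_gt0 ?invr_gt0 ?divr_gt0//.
rewrite !ln_powR !lnM ?posrE ?invr_gt0// !lnV ?posrE// => me eE UW.
rewrite -ler_ln ?posrE ?mulr_gt0 ?powR_gt0//.
rewrite !lnM ?posrE ?mulr_gt0 ?powR_gt0// !ln_powR.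
set k := s * b / a in k1 *.
have {}UW : s * (ln U - ln m) + k * (ln S - ln m) <= s * ln W.
  have -> : s * (ln U - ln m) + k * (ln S - ln m) =
      s * (ln U - ln m + b / a * (ln S - ln m)) by rewrite /k; ring.
  by rewrite ler_pM2l.
have {}me : k * ln m <= k * (ln 2 + (b^-1 / s * ln UE + (1 - b^-1 / s) * ln SE)).
  by rewrite ler_pM2l ?(lt_le_trans _ k1)// (le_trans me)// lerD2l.
have kE : k * (b^-1 / s) = a^-1 by rewrite /k; field; rewrite !gt_eqF.
(* Here [1 <= k] is decisive: [S] remains with the exponent 1 - k, and passing to [SE] goes in the
   right direction only if that is nonpositive. *)
have {}SES : (k - 1) * ln SE <= (k - 1) * ln S by rewrite ler_wpM2l// subr_ge0.
have -> : a^-1 * ln UE = k * (b^-1 / s) * ln UE by rewrite kE.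
have -> : (1 - a^-1) * ln SE = (1 - k * (b^-1 / s)) * ln SE by rewrite kE.
by move: UW me SES; set z := b^-1 / s; clear; lra.
Qed.

End sums.

(** * The bilinear estimate *)

Section bilinear.
Context d (T : measurableType d) (R : realType).
Variable mu : {measure set T -> \bar R}.
Implicit Types (Q D : set T) (F : seq (set T)) (E : set T -> set T).

Definition average (h rho : T -> R) Q : R :=
  fine (\int[mu]_(x in Q) (h x * rho x)%:E) / fine (\int[mu]_(x in Q) (rho x)%:E).

(** The map [E] is arbitrary rather than computed from [F]: it will come from the full family, so
    that one choice of disjoint parts serves all finite subfamilies. The order of [F] is the one
    required by the Doob induction. *)
Definition sparse_list F E := [/\ uniq F, leaf_first F,
  forall Q, Q \in F -> [/\ measurable Q, (0 < mu Q < +oo)%E, measurable (E Q),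
    E Q `<=` Q & (mu Q <= 2%:E * mu (E Q))%E] &
  forall Q P, Q \in F -> P \in F -> Q != P -> E Q `&` E P = set0].

Lemma ge0_fine_EFin (x : \bar R) : (0 <= x < +oo)%E -> (fine x)%:E = x.
Proof. by case: x => //= /andP[]. Qed.

Lemma integral_nneg D (k : T -> R) : (forall x, 0 <= k x) ->
  (0 <= \int[mu]_(x in D) (k x)%:E)%E.
Proof. by move=> k0; apply: integral_ge0 => x _; rewrite lee_fin. Qed.

Lemma integral_subset_nneg D D' (k : T -> R) : measurable D -> measurable D' ->
  measurable_fun setT k -> (forall x, 0 <= k x) -> D `<=` D' ->
  (\int[mu]_(x in D) (k x)%:E <= \int[mu]_(x in D') (k x)%:E)%E.
Proof.
move=> mD mD' mk k0; apply: ge0_subset_integral => //; last first.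
  by move=> x _; rewrite lee_fin.
by apply/measurable_EFinP; apply: measurable_funTS.
Qed.

Lemma integral_subset_lty D D' (k : T -> R) : measurable D -> measurable D' ->
  measurable_fun setT k -> (forall x, 0 <= k x) -> D `<=` D' ->
  (\int[mu]_(x in D') (k x)%:E < +oo)%E -> (\int[mu]_(x in D) (k x)%:E < +oo)%E.
Proof. by move=> *; apply: le_lt_trans (integral_subset_nneg _ _ _ _ _) _; eauto. Qed.

Lemma fine_integral_interpolation D (k k1 k2 : T -> R) (t : R) : measurable D ->
  measurable_fun setT k1 -> measurable_fun setT k2 ->
  (forall x, 0 <= k1 x) -> (forall x, 0 <= k2 x) -> 0 < t -> t < 1 ->
  (forall x, k x = k1 x `^ t * k2 x `^ (1 - t)) ->
  (\int[mu]_(x in D) (k1 x)%:E < +oo)%E ->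
  (\int[mu]_(x in D) (k2 x)%:E < +oo)%E ->
  (\int[mu]_(x in D) (k x)%:E < +oo)%E /\
  fine (\int[mu]_(x in D) (k x)%:E) <=
  fine (\int[mu]_(x in D) (k1 x)%:E) `^ t *
  fine (\int[mu]_(x in D) (k2 x)%:E) `^ (1 - t).
Proof.
move=> mD m1 m2 k10 k20 t0 t1 kE.
have := integral_interpolation mu mD m1 m2 k10 k20 t0 t1.
under eq_integral do rewrite -kE.
have k0 x : 0 <= k x by rewrite kE mulr_ge0 ?powR_ge0.
have := integral_nneg D k0.
have := integral_nneg D k10; have := integral_nneg D k20.
case: (\int[mu]_(x in D) (k1 x)%:E)%E => [I1|//|//].
case: (\int[mu]_(x in D) (k2 x)%:E)%E => [I2|//|//].
rewrite !poweR_EFin -EFinM.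
case: (\int[mu]_(x in D) (k x)%:E)%E => [I|//|//].
by rewrite lee_fin => _ _ _ H _ _; rewrite ltry.
Qed.

(** Hoelder's inequality for h rho = (h^t rho)^(1/t) rho^(1 - 1/t) makes the numerator of the
    average finite; together with 0 < rho(Q) < oo this makes the quotient a genuine average. *)
Lemma is_average_average (h rho : T -> R) (t : R) Q :
  measurable_fun setT h -> measurable_fun setT rho ->
  (forall x, 0 <= h x) -> (forall x, 0 <= rho x) -> 1 < t -> measurable Q ->
  (0 < \int[mu]_(x in Q) (rho x)%:E < +oo)%E ->
  (\int[mu]_x (h x `^ t * rho x)%:E < +oo)%E ->
  (\int[mu]_(x in Q) (h x * rho x)%:E < +oo)%E /\
  is_average mu h rho (average h rho) Q.
Proof.
move=> mh mr h0 r0 t1 mQ /andP[rp rfin] hfin.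
have tp : 0 < t by rewrite (lt_trans _ t1).
have ti : 0 < t^-1 by rewrite invr_gt0.
have ti1 : t^-1 < 1 by rewrite invf_lt1.
have m1 : measurable_fun setT (fun x => h x `^ t * rho x).
  by apply: measurable_funM => //; exact: measurable_powR_comp.
have p1 x : 0 <= h x `^ t * rho x by rewrite mulr_ge0 ?powR_ge0.
have [//|| hr _] := @fine_integral_interpolation Q (fun x => h x * rho x) _ _ t^-1
   mQ m1 mr p1 r0 ti ti1 _ _ rfin.
- move=> x; rewrite powRM ?powR_ge0// -powRrM mulfV ?gt_eqF// powRr1//.
  by rewrite -mulrA powR_mul_compl.
- exact: integral_subset_lty hfin.
have hr0 x : 0 <= h x * rho x by rewrite mulr_ge0.
split=> //; split=> //.
  by rewrite /average divr_ge0// fine_ge0// integral_nneg.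
rewrite -[X in (_ * X)%E]ge0_fine_EFin ?(ltW rp)// -EFinM /average divfK; last first.
  by rewrite gt_eqF// fine_gt0// rp.
by rewrite ge0_fine_EFin// integral_nneg.
Qed.

End bilinear.

(** The averages [x] and [y] are moved into the two Hoelder factors. Since (a s) / a = s and a' (1 -
    1/a) = 1 for a' = a/(a - 1), these factors become terms of Doob sums with the exponents a s and
    a'. *)
Lemma sparse_term_rearrange (R : realType) (a s x y g S U SE UE c K : R) :
  1 < a -> 0 <= x -> 0 <= y -> 0 <= g -> 0 <= U -> 0 <= UE -> 0 <= SE ->
  c * S * U `^ s <= K * (SE `^ (1 - a^-1) * UE `^ a^-1) ->
  c * (x * S) * ((y * U) `^ s * g) <=
  K * g * ((y `^ (a * s) * UE) `^ a^-1 *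
           (x `^ (a / (a - 1)) * SE) `^ (1 - a^-1)).
Proof.
move=> a1 x0 y0 g0 U0 UE0 SE0 tb.
have a0 : 0 < a by rewrite (lt_trans _ a1).
have am : 0 < a - 1 by rewrite subr_gt0.
rewrite !powRM ?powR_ge0// -!powRrM.
have -> : a * s * a^-1 = s by rewrite mulrAC mulfV ?mul1r// gt_eqF.
have -> : a / (a - 1) * (1 - a^-1) = 1 by field; rewrite !gt_eqF.
rewrite powRr1//.
have xyg : 0 <= x * y `^ s * g by rewrite !mulr_ge0 ?powR_ge0.
have {tb} := ler_wpM2l xyg tb.
rewrite -subr_ge0 => tb; rewrite -subr_ge0; apply: le_trans tb _.
by rewrite le_eqVlt; apply/orP; left; apply/eqP; ring.
Qed.

(** * The bilinear estimate when 1 <= s b / a *)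

Section sparse_bilinear.
Context d (T : measurableType d) (R : realType).
Variable mu : {measure set T -> \bar R}.
Variables (F : seq (set T)) (E : set T -> set T).
Variables (a b s W : R) (phi sg g u : T -> R).
Hypotheses (spF : sparse_list mu F E).
Hypotheses (a1 : 1 < a) (b1 : 1 < b) (sE : s = a^-1 + b^-1) (s1 : s < 1).
Hypothesis k1 : 1 <= s * b / a.
Hypotheses (mphi : measurable_fun setT phi) (msg : measurable_fun setT sg)
  (mg : measurable_fun setT g) (mu_ : measurable_fun setT u).
Hypotheses (phi0 : forall x, 0 <= phi x) (sg0 : forall x, 0 <= sg x)
  (g0 : forall x, 0 <= g x) (u0 : forall x, 0 <= u x).
Hypothesis usg : forall x, u x `^ b^-1 * sg x `^ a^-1 = 1.

Local Notation m Q := (fine (mu Q)).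
Local Notation int D k := (fine (\int[mu]_(x in D) (k x)%:E)).

Hypothesis weightF : forall Q, Q \in F ->
  [/\ (\int[mu]_(x in Q) (u x)%:E < +oo)%E,
      (\int[mu]_(x in Q) (sg x)%:E < +oo)%E &
      int Q u / m Q * (int Q sg / m Q) `^ (b / a) <= W].
Hypothesis phi_fin : (\int[mu]_x (phi x `^ (a / (a - 1)) * sg x)%:E < +oo)%E.
Hypothesis g_fin : (\int[mu]_x (g x `^ (b / (b - 1)) * u x)%:E < +oo)%E.

Let a0 : 0 < a. Proof. by rewrite (lt_trans _ a1). Qed.
Let b0 : 0 < b. Proof. by rewrite (lt_trans _ b1). Qed.
Let s0 : 0 < s. Proof. by rewrite sE addr_gt0 ?invr_gt0. Qed.
Let am : 0 < a - 1. Proof. by rewrite subr_gt0. Qed.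
Let bm : 0 < b - 1. Proof. by rewrite subr_gt0. Qed.

(** Raising [usg] to the power 1/s writes the constant 1 as u^z sg^(1-z) with z = b^-1 / s, because
    1 - z = a^-1 / s; Hoelder's inequality is applied on [E Q] to this factorisation. *)
Let measure_le Q : Q \in F ->
  m (E Q) <= int (E Q) u `^ (b^-1 / s) * int (E Q) sg `^ (1 - b^-1 / s).
Proof.
move=> QF; have [_ _ /(_ _ QF)[mQ _ mE EQ _] _] := spF.
have [uf sf _] := weightF QF.
have [] := @fine_integral_interpolation _ _ _ mu (E Q) (cst 1) u sg (b^-1 / s)
    mE mu_ msg u0 sg0 _ _ _ _ _.
- by rewrite divr_gt0 ?invr_gt0.
- by rewrite ltr_pdivrMr// mul1r sE ltrDr invr_gt0.
- move=> x /=.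
  have -> : 1 - b^-1 / s = a^-1 / s.
    by rewrite sE; field; rewrite !gt_eqF// ?addr_gt0.
  by rewrite !powRrM -powRM ?powR_ge0// usg powR1.
- exact: integral_subset_lty uf.
- exact: integral_subset_lty sf.
- by have := integral_cst mu mE 1%E; rewrite mul1e => <-.
Qed.

(** Positivity of the weighted measures of Q is deduced from [measure_le]: the set [E Q] has
    positive measure, so neither weight can vanish on it in integral. *)
Let facts Q : Q \in F ->
  [/\ 0 < m Q, m Q <= 2 * m (E Q),
     (0 < \int[mu]_(x in Q) (u x)%:E < +oo)%E &
     (0 < \int[mu]_(x in Q) (sg x)%:E < +oo)%E] /\
  [/\ (\int[mu]_(x in E Q) (u x)%:E < +oo)%E,
     (\int[mu]_(x in E Q) (sg x)%:E < +oo)%E,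
     int (E Q) sg <= int Q sg & int (E Q) u <= int Q u].
Proof.
move=> QF; have [_ _ /(_ _ QF)[mQ /andP[m0 mfin] mE EQ sp] _] := spF.
have [uf sf _] := weightF QF.
have EQm : (mu (E Q) <= mu Q)%E by apply: le_measure; rewrite ?inE.
have m0' : 0 < m Q by rewrite fine_gt0// m0.
have sp' : m Q <= 2 * m (E Q).
  rewrite -lee_fin EFinM !ge0_fine_EFin ?measure_ge0//.
  exact: le_lt_trans mfin.
have Efin (k : T -> R) : measurable_fun setT k -> (forall x, 0 <= k x) ->
    (\int[mu]_(x in Q) (k x)%:E < +oo)%E ->
    (\int[mu]_(x in E Q) (k x)%:E < +oo)%E.
  by move=> mk k0; exact: integral_subset_lty.
have EQle (k : T -> R) : measurable_fun setT k -> (forall x, 0 <= k x) ->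
    (\int[mu]_(x in Q) (k x)%:E < +oo)%E -> int (E Q) k <= int Q k.
  move=> mk k0 kf; rewrite fine_le ?ge0_fin_numE ?integral_nneg ?Efin//.
  exact: integral_subset_nneg.
have [uE sgE] := (EQle _ mu_ u0 uf, EQle _ msg sg0 sf).
have e0 : 0 < m (E Q) by rewrite -(@pmulr_rgt0 _ 2)// (lt_le_trans m0').
have th0 : b^-1 / s != 0 by rewrite mulf_neq0 ?invr_eq0 ?gt_eqF.
have th1 : 1 - b^-1 / s != 0.
  rewrite (_ : 1 - b^-1 / s = a^-1 / s).
    by rewrite mulf_neq0 ?invr_eq0 ?gt_eqF.
  by rewrite sE; field; rewrite !gt_eqF// ?addr_gt0.
have pos (k : T -> R) : measurable_fun setT k -> (forall x, 0 <= k x) ->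
    int (E Q) k != 0 -> (0 < \int[mu]_(x in Q) (k x)%:E)%E.
  move=> mk k0 nz; apply: lt_le_trans (integral_subset_nneg mu mE mQ mk k0 EQ).
  rewrite lt_neqAle integral_nneg// andbT; apply: contra nz => /eqP <-.
  by rewrite fine0.
split; split=> //; try exact: Efin.
- rewrite uf andbT; apply: pos => //.
  apply: contraTneq (lt_le_trans e0 (measure_le QF)) => ->.
  by rewrite powR0// mul0r ltxx.
- rewrite sf andbT; apply: pos => //.
  apply: contraTneq (lt_le_trans e0 (measure_le QF)) => ->.
  by rewrite (powR0 th1)// mulr0 ltxx.
Qed.

(** With b' = b/(b - 1), this [r] satisfies r a s = b', so that Doob's inequality for g^r at the
    exponent a s returns the norm of [g], and also r s + b' (1 - s) = 1, so that g u can be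
    interpolated between g^r u and g^b' u. *)
Let r := b / (b - 1) / (a * s).
Let X := average mu phi sg.
Let Y := average mu (fun x => g x `^ r) u.
Let G := fine (\int[mu]_x (g x `^ (b / (b - 1)) * u x)%:E).
Let Phi := fine (\int[mu]_x (phi x `^ (a / (a - 1)) * sg x)%:E).

Let as1 : 1 < a * s.
Proof. by rewrite sE mulrDr mulfV ?gt_eqF// ltrDl divr_gt0. Qed.

Let grE x : (g x `^ r) `^ (a * s) = g x `^ (b / (b - 1)).
Proof. by rewrite -powRrM /r divfK// gt_eqF// (lt_trans _ as1). Qed.

Let phi_average Q : Q \in F -> is_average mu phi sg X Q.
Proof.
move=> QF; have [_ _ /(_ _ QF)[mQ _ _ _ _] _] := spF.
have [[_ _ _ sf] _] := facts QF.
have a'1 : 1 < a / (a - 1) by rewrite ltr_pdivlMr// mul1r ltrBlDr ltrDl.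
by have [] := is_average_average mphi msg phi0 sg0 a'1 mQ sf phi_fin.
Qed.

Let g_average Q : Q \in F ->
  (\int[mu]_(x in Q) (g x `^ r * u x)%:E < +oo)%E /\
  is_average mu (fun x => g x `^ r) u Y Q.
Proof.
move=> QF; have [_ _ /(_ _ QF)[mQ _ _ _ _] _] := spF.
have [[_ _ uf _] _] := facts QF.
have gr0 x : 0 <= g x `^ r by exact: powR_ge0.
have mgr := measurable_powR_comp r mg.
have gf : (\int[mu]_x ((g x `^ r) `^ (a * s) * u x)%:E < +oo)%E.
  by under eq_integral do rewrite grE.
exact: (is_average_average mgr mu_ gr0 u0 as1 mQ uf gf).
Qed.

Let fine_doob (h rho : T -> R) (al : set T -> R) (t : R) :
  measurable_fun setT h -> measurable_fun setT rho ->
  (forall x, 0 <= h x) -> (forall x, 0 <= rho x) -> 1 < t ->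
  (forall Q, Q \in F -> is_average mu h rho al Q) ->
  (\int[mu]_x (h x `^ t * rho x)%:E < +oo)%E ->
  \sum_(Q <- F) al Q `^ t * int (E Q) rho <=
  (t / (t - 1)) `^ t * fine (\int[mu]_x (h x `^ t * rho x)%:E).
Proof.
move=> mh mr h0 r0 t1 av hf; have [uF lF spE dE] := spF.
have EE Q : Q \in F -> measurable (E Q) /\ E Q `<=` Q by move=> /spE[].
have := @doob_sparse _ _ _ mu h rho t al mh mr h0 r0 t1 E F uF lF av EE dE hf.
have p1 x : 0 <= h x `^ t * rho x by rewrite mulr_ge0 ?powR_ge0.
have H0 := integral_nneg mu setT p1.
rewrite -[X in (_ <= _ * X)%E -> _]ge0_fine_EFin ?H0// -EFinM.
rewrite big_seq.
under eq_bigr => Q QF.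
  rewrite -[X in (_ * X)%E]ge0_fine_EFin; last first.
    rewrite integral_nneg//=; have [mQ _ mE EQ _] := spE _ QF.
    by have [_ _ rf _] := av _ QF; exact: integral_subset_lty rf.
  over.
rewrite /= -big_seq.
under eq_bigr do rewrite -EFinM.
by rewrite sumEFin lee_fin.
Qed.

Let int_g_le Q : Q \in F ->
  int Q (fun x => g x * u x) <= (Y Q * int Q u) `^ s * G `^ (1 - s).
Proof.
move=> QF; have [_ _ /(_ _ QF)[mQ _ _ _ _] _] := spF.
have [gr [_ _ uf YE]] := g_average QF.
have p1 x : 0 <= g x `^ r * u x by rewrite mulr_ge0 ?powR_ge0.
have p2 x : 0 <= g x `^ (b / (b - 1)) * u x by rewrite mulr_ge0 ?powR_ge0.
have m1 : measurable_fun setT (fun x => g x `^ r * u x).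
  by apply: measurable_funM => //; exact: measurable_powR_comp.
have m2 : measurable_fun setT (fun x => g x `^ (b / (b - 1)) * u x).
  by apply: measurable_funM => //; exact: measurable_powR_comp.
have g_finQ := integral_subset_lty mQ measurableT m2 p2 (@subsetT _ _) g_fin.
have [|_ le1] := @fine_integral_interpolation _ _ _ mu Q (fun x => g x * u x)
  _ _ s mQ m1 m2 p1 p2 s0 s1 _ gr g_finQ.
  move=> x; rewrite !powRM ?powR_ge0// -!powRrM mulrACA powR_mul_compl//.
  have e1 : r * s + b / (b - 1) * (1 - s) = 1.
    by rewrite /r sE; field; rewrite !gt_eqF// ?addr_gt0.
  have := @powRD _ (g x) (r * s) (b / (b - 1) * (1 - s)).
  by rewrite e1 oner_eq0 => /(_ isT) <-; rewrite powRr1.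
apply: le_trans le1 _.
have YI : Y Q * int Q u = int Q (fun x => g x `^ r * u x).
  have -> : int Q (fun x => g x `^ r * u x) = fine ((Y Q)%:E *
      \int[mu]_(x in Q) (u x)%:E)%E by rewrite YE.
  by rewrite fineM// ge0_fin_numE// integral_nneg.
(* The second Hoelder factor is enlarged from Q to the whole space; it then no longer depends on Q
   and leaves the sum. *)
rewrite YI; apply: ler_wpM2l; first exact: powR_ge0.
apply: ge0_ler_powR.
- by rewrite subr_ge0 ltW.
- by rewrite nnegrE fine_ge0// integral_nneg.
- by rewrite nnegrE fine_ge0// integral_nneg.
- apply: fine_le.
  + by rewrite ge0_fin_numE; [exact: g_finQ | exact: integral_nneg].
  + by rewrite ge0_fin_numE; [exact: g_fin | exact: integral_nneg].
  + exact: integral_subset_nneg.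
Qed.

Let term_le Q : Q \in F ->
  m Q `^ (- s) * int Q (fun x => phi x * sg x) * int Q (fun x => g x * u x) <=
  2 `^ (s * b / a) * W `^ s * G `^ (1 - s) *
  ((Y Q `^ (a * s) * int (E Q) u) `^ a^-1 *
   (X Q `^ (a / (a - 1)) * int (E Q) sg) `^ (1 - a^-1)).
Proof.
move=> QF.
have [[m0 me /andP[U0 Uf] /andP[S0 Sf]] [_ _ sgE uE]] := facts QF.
have [_ _ UW] := weightF QF.
have [_ X0 _ XE] := phi_average QF; have [_ [_ Y0 _ _]] := g_average QF.
have -> : int Q (fun x => phi x * sg x) = X Q * int Q sg.
  by rewrite -XE fineM// ge0_fin_numE// ltW.
have se : 0 <= int (E Q) sg by rewrite fine_ge0// integral_nneg.
have ue : 0 <= int (E Q) u by rewrite fine_ge0// integral_nneg.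
have Ip : 0 <= int Q sg by rewrite fine_ge0// ltW.
have Up : 0 <= int Q u by rewrite fine_ge0// ltW.
have P0 : 0 <= m Q `^ (- s) * (X Q * int Q sg).
  apply: mulr_ge0; first exact: powR_ge0.
  exact: mulr_ge0.
apply: le_trans (ler_wpM2l P0 (int_g_le QF)) _.
have tb := sparse_term_bound a1 b1 sE k1 m0 me se ue sgE uE (measure_le QF) UW.
exact: (sparse_term_rearrange a1 X0 Y0 (powR_ge0 _ _) Up ue se tb).
Qed.

(** Hoelder's inequality for sums with the weights 1/a and 1 - 1/a produces two Doob sums. The one
    for [phi] has exponent a/(a - 1) and constant [a]; the one for g^r has exponent a s = 1 + a/b,
    whose conjugate is 1 + b/a. The powers of [G] recombine because (1 - s) + 1/a = 1 - 1/b. *)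
Lemma sparse_bilinear :
  \sum_(Q <- F) m Q `^ (- s) * int Q (fun x => phi x * sg x) *
                int Q (fun x => g x * u x) <=
  a * (1 + b / a) `^ s * 2 `^ (s * b / a) * W `^ s *
  (Phi `^ (1 - a^-1) * G `^ (1 - b^-1)).
Proof.
have ai : 0 < a^-1 by rewrite invr_gt0.
have ai1 : a^-1 < 1 by rewrite invf_lt1.
have nn D (k : T -> R) : (forall x, 0 <= k x) -> 0 <= int D k.
  by move=> k0; rewrite fine_ge0// integral_nneg.
rewrite big_seq; apply: le_trans (ler_sum _ (fun Q QF => term_le QF)) _.
rewrite -big_seq -mulr_sumr.
apply: le_trans (ler_wpM2l _ (sum_interpolation F _ _ ai ai1)) _.
- by rewrite !mulr_ge0 ?powR_ge0.
- by move=> Q; rewrite mulr_ge0 ?powR_ge0 ?nn.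
- by move=> Q; rewrite mulr_ge0 ?powR_ge0 ?nn.
have a'1 : 1 < a / (a - 1) by rewrite ltr_pdivlMr// mul1r ltrBlDr ltrDl.
have D1 := fine_doob mphi msg phi0 sg0 a'1 phi_average phi_fin.
have gr0 x : 0 <= g x `^ r by exact: powR_ge0.
have mgr := measurable_powR_comp r mg.
have GE : (\int[mu]_x ((g x `^ r) `^ (a * s) * u x)%:E =
    \int[mu]_x (g x `^ (b / (b - 1)) * u x)%:E)%E.
  by apply: eq_integral => x _; rewrite grE.
have gav Q (QF : Q \in F) := (g_average QF).2.
have gf : (\int[mu]_x ((g x `^ r) `^ (a * s) * u x)%:E < +oo)%E by rewrite GE.
have D2 := fine_doob mgr mu_ gr0 u0 as1 gav gf.
rewrite GE -/G in D2.
have Phi0 : 0 <= Phi by apply: nn => x; rewrite mulr_ge0 ?powR_ge0.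
have G0 : 0 <= G by apply: nn => x; rewrite mulr_ge0 ?powR_ge0.
have c1 : a / (a - 1) / (a / (a - 1) - 1) = a.
  have -> : a / (a - 1) - 1 = (a - 1)^-1 by field; rewrite gt_eqF.
  by rewrite invrK divfK ?gt_eqF.
have c2 : a * s / (a * s - 1) = 1 + b / a.
  have -> : a * s = 1 + a / b by rewrite sE mulrDr mulfV ?gt_eqF.
  by rewrite [X in _ / X]addrC addKr; field; rewrite !gt_eqF.
have H1 : (\sum_(Q <- F) X Q `^ (a / (a - 1)) * int (E Q) sg) `^ (1 - a^-1) <=
    a * Phi `^ (1 - a^-1).
  apply: le_trans (ge0_ler_powR _ _ _ D1) _; rewrite ?nnegrE.
  - by rewrite subr_ge0 ltW.
  - by apply: sumr_ge0 => Q _; rewrite mulr_ge0 ?powR_ge0 ?nn.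
  - by rewrite mulr_ge0 ?powR_ge0.
  rewrite c1 (powRM _ (powR_ge0 _ _) Phi0) -powRrM.
  have -> : a / (a - 1) * (1 - a^-1) = 1 by field; rewrite !gt_eqF.
  rewrite (powRr1 (ltW a0)); exact: lexx.
have H2 : (\sum_(Q <- F) Y Q `^ (a * s) * int (E Q) u) `^ a^-1 <=
    (1 + b / a) `^ s * G `^ a^-1.
  apply: le_trans (ge0_ler_powR _ _ _ D2) _; rewrite ?nnegrE.
  - exact: ltW.
  - by apply: sumr_ge0 => Q _; rewrite mulr_ge0 ?powR_ge0 ?nn.
  - by rewrite mulr_ge0 ?powR_ge0.
  rewrite c2 (powRM _ (powR_ge0 _ _) G0) -powRrM.
  have -> : a * s * a^-1 = s by rewrite mulrAC mulfV ?mul1r// gt_eqF.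
  exact: lexx.
have K0 : 0 <= 2 `^ (s * b / a) * W `^ s * G `^ (1 - s).
  by rewrite !mulr_ge0 ?powR_ge0.
apply: le_trans (ler_wpM2l K0 (ler_pM (powR_ge0 _ _) (powR_ge0 _ _) H2 H1)) _.
have -> : G `^ (1 - b^-1) = G `^ (1 - s) * G `^ a^-1.
  have e : 1 - s + a^-1 = 1 - b^-1 by rewrite sE; ring.
  by rewrite -powRD e// subr_eq0 eq_sym invr_eq1 gt_eqF.
move: (Phi `^ _) (G `^ (1 - s)) (G `^ a^-1) => A B C.
by rewrite le_eqVlt; apply/orP; left; apply/eqP; ring.
Qed.

End sparse_bilinear.

(** The conjugate exponents are variables here, so that the estimate applies to (p', q) and to (q,
    p') alike, with [p] itself in the place of the conjugate of p'. *)
Lemma sparse_bilinear_conj d (T : measurableType d) (R : realType)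
    (mu : {measure set T -> \bar R}) (F : seq (set T)) (E : set T -> set T)
    (a b a' b' s W : R) (phi sg g u : T -> R) :
  sparse_list mu F E -> 1 < a -> 1 < b -> s = a^-1 + b^-1 -> s < 1 ->
  1 <= s * b / a -> a' = a / (a - 1) -> b' = b / (b - 1) ->
  measurable_fun setT phi -> measurable_fun setT sg ->
  measurable_fun setT g -> measurable_fun setT u ->
  (forall x, 0 <= phi x) -> (forall x, 0 <= sg x) ->
  (forall x, 0 <= g x) -> (forall x, 0 <= u x) ->
  (forall x, u x `^ b^-1 * sg x `^ a^-1 = 1) ->
  (forall Q, Q \in F ->
    [/\ (\int[mu]_(x in Q) (u x)%:E < +oo)%E,
        (\int[mu]_(x in Q) (sg x)%:E < +oo)%E &
        fine (\int[mu]_(x in Q) (u x)%:E) / fine (mu Q) *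
        (fine (\int[mu]_(x in Q) (sg x)%:E) / fine (mu Q)) `^ (b / a) <= W]) ->
  (\int[mu]_x (phi x `^ a' * sg x)%:E < +oo)%E ->
  (\int[mu]_x (g x `^ b' * u x)%:E < +oo)%E ->
  \sum_(Q <- F) fine (mu Q) `^ (- s) *
    fine (\int[mu]_(x in Q) (phi x * sg x)%:E) *
    fine (\int[mu]_(x in Q) (g x * u x)%:E) <=
  a * (1 + b / a) `^ s * 2 `^ (s * b / a) * W `^ s *
  (fine (\int[mu]_x (phi x `^ a' * sg x)%:E) `^ a'^-1 *
   fine (\int[mu]_x (g x `^ b' * u x)%:E) `^ b'^-1).
Proof.
move=> spF a1 b1 sE s1 k1 -> -> mphi msg mg mu_ phi0 sg0 g0 u0 usg wF phif gf.
have conjV (c : R) : 1 < c -> (c / (c - 1))^-1 = 1 - c^-1.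
  move=> c1; field; rewrite !gt_eqF ?subr_gt0// (lt_trans _ c1)//.
by rewrite (conjV _ a1) (conjV _ b1); exact: (sparse_bilinear spF).
Qed.

(** * The operator on finite subfamilies *)

(** With t = q/p' this exchanges the two weights in the A_{p,q} condition, at the price of replacing
    [W] by W^(p'/q). The exponent max(1, p'/q) of the weight constant originates here. *)
Lemma powR_swap (R : realType) (t U S W : R) : 0 < t -> 0 <= U -> 0 <= S ->
  U * S `^ t <= W -> S * U `^ t^-1 <= W `^ t^-1.
Proof.
move=> t0 U0 S0 UW.
have US0 : 0 <= U * S `^ t by rewrite mulr_ge0 ?powR_ge0.
have t1 : 0 <= t^-1 by rewrite invr_ge0 ltW.
have W0 : 0 <= W by exact: le_trans UW.
have := ge0_ler_powR t1 US0 W0 UW.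
rewrite (powRM _ U0 (powR_ge0 _ _)) -powRrM mulfV ?gt_eqF//.
by rewrite (powRr1 S0) mulrC.
Qed.

Section sparse_operator.
Context d (T : measurableType d) (R : realType).
Variable mu : {measure set T -> \bar R}.
Variables (F : seq (set T)) (E : set T -> set T).
Variables (p p' q q' s W : R) (v : T -> R).
Hypotheses (p'E : p' = p / (p - 1)) (q'E : q' = q / (q - 1)).
Hypotheses (spF : sparse_list mu F E).
Hypotheses (p1 : 1 < p) (q1 : 1 < q) (sE : s = q^-1 + p'^-1) (s1 : s < 1).
Hypothesis mins : Num.min (p' / q) (q / p') <= s.
Hypotheses (mv : measurable_fun setT v) (v0 : forall x, 0 < v x).

Local Notation m Q := (fine (mu Q)).
Local Notation int D k := (fine (\int[mu]_(x in D) (k x)%:E)).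
Local Notation u := (fun x => v x `^ q).
Local Notation sg := (fun x => v x `^ (- p')).

Hypothesis weightF : forall Q, Q \in F ->
  [/\ (\int[mu]_(x in Q) (u x)%:E < +oo)%E,
      (\int[mu]_(x in Q) (sg x)%:E < +oo)%E &
      int Q u / m Q * (int Q sg / m Q) `^ (q / p') <= W].

Definition sparse_const : R :=
  p' * (1 + q / p') `^ s * 2 `^ (s * Num.max (q / p') (p' / q)) *
  W `^ (s * Num.max 1 (p' / q)).

Let p0 : 0 < p. Proof. by rewrite (lt_trans _ p1). Qed.
Let q0 : 0 < q. Proof. by rewrite (lt_trans _ q1). Qed.
Let pm : 0 < p - 1. Proof. by rewrite subr_gt0. Qed.
Let qm : 0 < q - 1. Proof. by rewrite subr_gt0. Qed.
Let p'0 : 0 < p'. Proof. by rewrite p'E divr_gt0. Qed.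
Let p'1 : 1 < p'. Proof. by rewrite p'E ltr_pdivlMr// mul1r ltrBlDr ltrDl. Qed.
Let p'V : 1 - p'^-1 = p^-1. Proof. by rewrite p'E; field; rewrite !gt_eqF. Qed.
Let p'' : p = p' / (p' - 1).
Proof.
have -> : p' - 1 = (p - 1)^-1 by rewrite p'E; field; rewrite gt_eqF.
by rewrite invrK p'E divfK// gt_eqF.
Qed.

Let mu_ : measurable_fun setT u. Proof. exact: measurable_powR_comp. Qed.
Let msg : measurable_fun setT sg. Proof. exact: measurable_powR_comp. Qed.
Let u0 x : 0 <= u x. Proof. exact: powR_ge0. Qed.
Let sg0 x : 0 <= sg x. Proof. exact: powR_ge0. Qed.

Let usg x : u x `^ q^-1 * sg x `^ p'^-1 = 1.
Proof.
have vx : 0 <= v x by exact: ltW.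
rewrite -!powRrM mulfV ?gt_eqF// mulNr mulfV ?gt_eqF//.
by rewrite powRN !powRr1// mulfV// gt_eqF.
Qed.

Lemma sparse_const_ge0 : 0 <= sparse_const.
Proof. by rewrite /sparse_const !mulr_ge0 ?powR_ge0 ?(ltW p'0). Qed.

Let sparse_constA : p' / q <= s ->
  p' * (1 + q / p') `^ s * 2 `^ (s * q / p') * W `^ s = sparse_const.
Proof.
move=> pq; have pq1 : p' / q < 1 by exact: le_lt_trans s1.
have qp1 : 1 < q / p'.
  by move: pq1; rewrite ltr_pdivrMr// mul1r ltr_pdivlMr// mul1r.
rewrite /sparse_const max_l; last by rewrite ltW// (lt_trans pq1).
by rewrite max_l ?mulr1 ?(ltW pq1)// mulrA.
Qed.

(* The dual estimate has the smaller constant, since here [q <= p']. *)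
Let sparse_constB : q / p' <= s ->
  q * (1 + p' / q) `^ s * 2 `^ (s * p' / q) * (W `^ (p' / q)) `^ s <=
  sparse_const.
Proof.
move=> qs; have qp1 : q / p' < 1 by exact: le_lt_trans s1.
have pq1 : 1 < p' / q.
  by move: qp1; rewrite ltr_pdivrMr// mul1r ltr_pdivlMr// mul1r.
rewrite /sparse_const max_r; last by rewrite ltW// (lt_trans qp1).
rewrite max_r ?(ltW pq1)// -powRrM [p' / q * s]mulrC -[s * p' / q]mulrA.
apply: ler_wpM2r; first exact: powR_ge0.
apply: ler_wpM2r; first exact: powR_ge0.
(* After this factorisation there remains q (p'/q)^s <= p', which holds because p'/q >= 1 and s <
   1. *)
have -> : 1 + p' / q = (1 + q / p') * (p' / q) by field; rewrite !gt_eqF.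
rewrite powRM; last 2 first.
- by rewrite addr_ge0// divr_ge0// ltW.
- by rewrite divr_ge0// ltW.
rewrite mulrCA mulrC; apply: ler_wpM2r; first exact: powR_ge0.
rewrite mulrC -ler_pdivlMr//.
rewrite -[leRHS]powRr1; last by rewrite divr_ge0 ?ltW.
by apply: ler_powR; exact: ltW.
Qed.

Let weightF_dual Q : Q \in F -> [/\ (\int[mu]_(x in Q) (sg x)%:E < +oo)%E,
      (\int[mu]_(x in Q) (u x)%:E < +oo)%E &
      int Q sg / m Q * (int Q u / m Q) `^ (p' / q) <= W `^ (p' / q)].
Proof.
move=> QF; have [uf sf UW] := weightF QF; split=> //.
have U0 : 0 <= int Q u / m Q.
  by rewrite divr_ge0 ?fine_ge0 ?measure_ge0// integral_nneg.
have S0 : 0 <= int Q sg / m Q.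
  by rewrite divr_ge0 ?fine_ge0 ?measure_ge0// integral_nneg.
have qp0 : 0 < q / p' by rewrite divr_gt0.
by have := powR_swap qp0 U0 S0 UW; rewrite invf_div.
Qed.

Lemma sparse_bilinear_const (phi g : T -> R) :
  measurable_fun setT phi -> measurable_fun setT g ->
  (forall x, 0 <= phi x) -> (forall x, 0 <= g x) ->
  (\int[mu]_x (phi x `^ p * sg x)%:E < +oo)%E ->
  (\int[mu]_x (g x `^ q' * u x)%:E < +oo)%E ->
  \sum_(Q <- F) m Q `^ (- s) * int Q (fun x => phi x * sg x) *
                int Q (fun x => g x * u x) <=
  sparse_const * (fine (\int[mu]_x (phi x `^ p * sg x)%:E) `^ p^-1 *
                  fine (\int[mu]_x (g x `^ q' * u x)%:E) `^ q'^-1).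
Proof.
move=> mphi mg phi0 g0 phif gf.
have [pq|pq] := leP (p' / q) s.
- have k1 : 1 <= s * q / p' by rewrite ler_pdivlMr// mul1r -ler_pdivrMr.
  have sE' : s = p'^-1 + q^-1 by rewrite addrC.
  rewrite -(sparse_constA pq).
  exact: (sparse_bilinear_conj spF p'1 q1 sE' s1 k1 p'' q'E
    mphi msg mg mu_ phi0 sg0 g0 u0 usg weightF phif gf).
- have qs : q / p' <= s by move: mins; rewrite ge_min leNgt pq.
  have k1 : 1 <= s * p' / q by rewrite ler_pdivlMr// mul1r -ler_pdivrMr.
  have usg' x : sg x `^ p'^-1 * u x `^ q^-1 = 1 by rewrite mulrC.
  have H := sparse_bilinear_conj spF q1 p'1 sE s1 k1 q'E p''
    mg mu_ mphi msg g0 u0 phi0 sg0 usg' weightF_dual gf phif.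
  apply: le_trans (ler_wpM2r _ (sparse_constB qs)); last first.
    by apply: mulr_ge0; exact: powR_ge0.
  rewrite [X in _ <= _ * X]mulrC.
  apply: le_trans H.
  under eq_bigr do rewrite mulrAC.
  exact: lexx.
Qed.

Definition sparse_sum (f : T -> R) (x : T) : R :=
  \sum_(Q <- F) m Q `^ (- s) * int Q f * \1_Q x.

Let c (f : T -> R) Q : R := m Q `^ (- s) * int Q f.

Let c_ge0 (f : T -> R) Q : (forall x, 0 <= f x) -> 0 <= c f Q.
Proof. by move=> f0; rewrite mulr_ge0 ?powR_ge0// fine_ge0// integral_nneg. Qed.

Lemma sparse_sum_ge0 (f : T -> R) x : (forall x, 0 <= f x) -> 0 <= sparse_sum f x.
Proof. by move=> f0; apply: sumr_ge0 => Q _; rewrite mulr_ge0// c_ge0. Qed.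

Lemma measurable_sparse_sum f : measurable_fun setT (sparse_sum f).
Proof.
have [_ _ spE _] := spF.
pose h Q x := if Q \in F then c f Q * \1_Q x else 0.
rewrite (_ : sparse_sum f = fun x => \sum_(Q <- F) h Q x); last first.
  apply/funext => x; rewrite /sparse_sum big_seq [RHS]big_seq.
  by apply: eq_bigr => Q QF; rewrite /h QF.
apply: measurable_sum => Q; rewrite /h.
case: (boolP (Q \in F)) => QF; last exact: measurable_cst.
apply: measurable_funM => //; apply: measurable_indic.
by have [] := spE _ QF.
Qed.

(** A finite sum is bounded and vanishes outside finitely many cubes, each of finite u-measure. This
    is the a priori finiteness behind the absorption in [sparse_sum_bound]. *)
Let bounded_fin (f : T -> R) (t : R) : 0 < t -> (forall x, 0 <= f x) ->
  (\int[mu]_x (sparse_sum f x `^ t * u x)%:E < +oo)%E.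
Proof.
move=> t0 f0; have [_ _ spE _] := spF.
pose B := \sum_(Q <- F) c f Q.
have B0 : 0 <= B by apply: sumr_ge0 => Q _; exact: c_ge0.
have fB x : sparse_sum f x <= B.
  by apply: ler_sum => Q _; rewrite ler_piMr ?c_ge0.
have mui Q : Q \in F -> measurable_fun setT (fun x => u x * \1_Q x).
  move=> /spE[mQ _ _ _ _].
  by apply: measurable_funM => //; exact: measurable_indic.
pose h Q x := (B `^ t * (u x * \1_Q x))%:E.
have mh Q : Q \in F -> measurable_fun setT (h Q).
  by move=> QF; apply/measurable_EFinP; apply: measurable_funM => //; exact: mui.
have h0 Q x : Q \in F -> (0 <= h Q x)%E.
  by move=> _; rewrite lee_fin !mulr_ge0 ?powR_ge0.
have sh0 x (P : pred (set T)) : (0 <= \sum_(Q <- F | P Q) h Q x)%E.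
  by rewrite big_seq_cond; apply: sume_ge0 => Q /andP[QF _]; exact: h0.
have le1 : (\int[mu]_x (sparse_sum f x `^ t * u x)%:E <=
    \int[mu]_x (\sum_(Q <- F) h Q x)%E)%E.
  apply: ge0_le_integral => //.
  - by move=> x _; rewrite lee_fin mulr_ge0 ?powR_ge0.
  - apply/measurable_EFinP; apply: measurable_funM => //.
    by apply: measurable_powR_comp; exact: measurable_sparse_sum.
  - exact: emeasurable_sum_in.
  (* Outside all cubes the sum is 0, and so is its power since t > 0; inside some cube Q the single
     summand [h Q x] already dominates. *)
  - move=> x _; have [[Q QF Qx]|no] := pselect (exists2 Q, Q \in F & Q x); last first.
      rewrite /sparse_sum big_seq big1; last first.
        move=> Q QF; rewrite indicE memNset ?mulr0// => Qx.
        by apply: no; exists Q.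
      by rewrite powR0 ?gt_eqF// mul0r; exact: sh0.
    have -> : (sparse_sum f x `^ t * u x)%:E =
        ((sparse_sum f x `^ t * u x)%:E + 0)%E by rewrite adde0.
    have [uF _ _ _] := spF.
    rewrite (bigD1_seq Q)//=; apply: leeD; last exact: sh0.
    rewrite /h indicE mem_set// mulr1 lee_fin ler_wpM2r//.
    by rewrite ge0_ler_powR ?nnegrE ?sparse_sum_ge0 ?(ltW t0).
apply: le_lt_trans le1 _; rewrite ge0_integral_sum_in// big_seq.
apply: lte_sum_pinfty => Q QF; rewrite /h.
under eq_integral do rewrite EFinM.
rewrite ge0_integralZl_EFin ?powR_ge0//; last 2 first.
- by move=> x _; rewrite lee_fin mulr_ge0.
- by apply/measurable_EFinP; exact: mui.
have [uf _ _] := weightF QF.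
rewrite -(integral_restrict_indic mu Q u) lte_mul_pinfty ?lee_fin ?powR_ge0//.
Qed.

Let sparse_sum_pairing (f h : T -> R) : (forall x, 0 <= f x) ->
  measurable_fun setT h -> (forall x, 0 <= h x) ->
  (\int[mu]_x (h x)%:E < +oo)%E ->
  (\int[mu]_x (sparse_sum f x * h x)%:E =
   (\sum_(Q <- F) m Q `^ (- s) * int Q f * int Q h)%:E)%E.
Proof.
move=> f0 mh h0 hf; have [_ _ spE _] := spF.
have hi0 Q x : 0 <= h x * \1_Q x by rewrite mulr_ge0.
transitivity (\int[mu]_x (\sum_(Q <- F) (c f Q)%:E * (h x * \1_Q x)%:E))%E.
  apply: eq_integral => x _; rewrite /sparse_sum mulr_suml -sumEFin.
  by apply: eq_bigr => Q _; rewrite -EFinM mulrAC mulrA.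
have mhi Q : Q \in F -> measurable_fun setT (EFin \o (fun x => h x * \1_Q x)).
  move=> /spE[mQ _ _ _ _]; apply/measurable_EFinP.
  by apply: measurable_funM => //; exact: measurable_indic.
rewrite ge0_integral_sum_in; last 2 first.
- by move=> Q QF; apply: measurable_funeM; exact: mhi.
- by move=> Q x _; apply: mule_ge0; rewrite lee_fin// c_ge0.
rewrite -sumEFin big_seq [RHS]big_seq; apply: eq_bigr => Q QF.
have [mQ _ _ _ _] := spE _ QF.
have hi0' x : setT x -> (0 <= (h x * \1_Q x)%:E)%E by rewrite lee_fin.
rewrite (ge0_integralZl_EFin mu measurableT hi0' (mhi _ QF) (c_ge0 Q f0)).
have hQ : (0 <= \int[mu]_(x in Q) (h x)%:E < +oo)%E.
  by rewrite integral_nneg//=; exact: integral_subset_lty hf.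
by rewrite -integral_restrict_indic [RHS]EFinM (ge0_fine_EFin hQ).
Qed.

(** For this [g] the pairing with g u is N, the integral of (I f)^q u, and (q - 1) q' = q makes the
    norm of [g] equal to N^(1 - 1/q). The bilinear estimate becomes self-improving, and no duality
    theorem for L^q is called upon. *)
Lemma sparse_sum_bound (f : T -> R) :
  measurable_fun setT f -> (forall x, 0 <= f x) ->
  (\int[mu]_x (f x `^ p * v x `^ p)%:E < +oo)%E ->
  (\int[mu]_x (sparse_sum f x `^ q * u x)%:E <=
   ((sparse_const *
     fine (\int[mu]_x (f x `^ p * v x `^ p)%:E) `^ p^-1) `^ q)%:E)%E.
Proof.
move=> mf f0 ff.
pose phi x := f x * v x `^ p'; pose g x := sparse_sum f x `^ (q - 1).
have vn x : v x != 0 by rewrite gt_eqF.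
have phisg x : phi x * sg x = f x.
  by rewrite /phi -mulrA powRN mulfV ?mulr1// gt_eqF// powR_gt0.
have phip x : phi x `^ p * sg x = f x `^ p * v x `^ p.
  rewrite /phi powRM ?powR_ge0// -powRrM -mulrA -powRD ?vn ?implybT//.
  by congr (_ * _ `^ _); rewrite p'E; field; rewrite gt_eqF.
have T0 x : 0 <= sparse_sum f x by exact: sparse_sum_ge0.
have gq x : g x `^ q' * u x = sparse_sum f x `^ q * u x.
  by rewrite /g -powRrM q'E mulrCA mulfV ?mulr1// gt_eqF.
have mphi : measurable_fun setT phi.
  by apply: measurable_funM => //; exact: measurable_powR_comp.
have mS := measurable_sparse_sum f.
have mg : measurable_fun setT g by exact: measurable_powR_comp.
have phi0 x : 0 <= phi x by rewrite mulr_ge0 ?powR_ge0.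
have g0 x : 0 <= g x by exact: powR_ge0.
have IphiE : (\int[mu]_x (phi x `^ p * sg x)%:E =
    \int[mu]_x (f x `^ p * v x `^ p)%:E)%E.
  by apply: eq_integral => x _; rewrite phip.
have IgE : (\int[mu]_x (g x `^ q' * u x)%:E =
    \int[mu]_x (sparse_sum f x `^ q * u x)%:E)%E.
  by apply: eq_integral => x _; rewrite gq.
have Nfin := bounded_fin q0 f0.
have := sparse_bilinear_const mphi mg phi0 g0.
rewrite IphiE IgE => /(_ ff Nfin).
have gu0 x : 0 <= g x * u x by rewrite mulr_ge0.
have mgu : measurable_fun setT (fun x => g x * u x) by exact: measurable_funM.
have gf : (\int[mu]_x (g x * u x)%:E < +oo)%E by exact: bounded_fin.
have NE : (\int[mu]_x (sparse_sum f x `^ q * u x)%:E =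
    (\sum_(Q <- F) m Q `^ (- s) * int Q (fun x => (phi x * sg x)%R) *
      int Q (fun x => (g x * u x)%R))%:E)%E.
  transitivity (\int[mu]_x (sparse_sum f x * (g x * u x))%:E)%E.
    by apply: eq_integral => x _; rewrite mulrA (mulr_powR_pred (T0 x) q0).
  rewrite (sparse_sum_pairing f0 mgu gu0 gf); congr EFin.
  apply: eq_bigr => Q _; congr (_ * fine _ * _).
  by apply: eq_integral => x _; rewrite phisg.
rewrite NE => le1.
rewrite /= in le1.
rewrite lee_fin.
set A := fine (\int[mu]_x (f x `^ p * v x `^ p)%:E) `^ p^-1 in le1 *.
have : 0 <= sparse_const * A by rewrite mulr_ge0 ?sparse_const_ge0 ?powR_ge0.
have : (0 <= \int[mu]_x (sparse_sum f x `^ q * u x)%:E)%E.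
  by apply: integral_nneg => x; rewrite mulr_ge0 ?powR_ge0.
rewrite NE lee_fin; move: le1; rewrite mulrA.
have q'V : q'^-1 = 1 - q^-1 by rewrite q'E; field; rewrite !gt_eqF.
move: (\sum_(Q <- F) _) (sparse_const * A) => N K; rewrite q'V => le1 N0 K0.
exact: ler_powR_absorb.
Qed.

End sparse_operator.

(** * Sparse families and monotone convergence *)

(** The index set is a subset of the naturals, so finite and empty families are covered without a
    case distinction; [P] discards the indices that name no member. *)
Lemma countable_enum (X : pointedType) (S : set X) : countable S ->
  exists (P : pred nat) (h : nat -> X), set_bij [set i | P i] S h.
Proof.
move=> /countable_injP[g ginj].
pose h i := xget point [set x | S x /\ g x = i].
have hK x : S x -> h (g x) = x.
  move=> Sx; rewrite /h; case: xgetP => [y _ [Sy gy]|/(_ x)[]//].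
  by apply: ginj; rewrite ?inE.
exists (fun i => `[< exists2 x, S x & g x = i >]), h; split.
- by move=> i /= /asboolP[x Sx <-]; rewrite hK.
- move=> i j; rewrite !inE => /asboolP[x Sx <-] /asboolP[y Sy <-].
  by rewrite !hK// => ->.
- by move=> x Sx; exists (g x); [apply/asboolP; exists x | exact: hK].
Qed.

Lemma exists_minimal_set (T : Type) (F : seq (set T)) : F != [::] ->
  exists2 Q, Q \in F & forall P, P \in F -> P `<=` Q -> P = Q.
Proof.
elim: F => [//|Q [_ _|M F IH _]].
  by exists Q => [|P]; rewrite ?mem_head// inE => /eqP.
have [//|N NF Nmin] := IH.
have [QN|QN] := pselect (Q `<=` N).
  exists Q => [|P]; first exact: mem_head.
  rewrite inE => /orP[/eqP//|PF] PQ.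
  have PN := Nmin P PF (subset_trans PQ QN).
  by apply/seteqP; split=> //; rewrite PN.
exists N => [|P]; first by rewrite inE NF orbT.
by rewrite inE => /orP[/eqP ->//|]; exact: Nmin.
Qed.

(** Minimal sets are extracted one after another. If a minimal Q meets P, nestedness leaves Q inside
    P or P inside Q, and in the latter case minimality gives P = Q. *)
Lemma leaf_first_perm (T : Type) (F : seq (set T)) : uniq F ->
  (forall Q P, Q \in F -> P \in F -> [set set0; P; Q] (Q `&` P)) ->
  exists2 F' : seq (set T), perm_eq F' F & leaf_first F'.
Proof.
have [n] := ubnP (size F); elim: n F => // n IH F.
have [->|F0] := eqVneq F [::]; first by exists [::].
have [Q QF Qmin] := exists_minimal_set F0 => szF uF nest.
have pF := perm_to_rem QF.
have sub P : P \in rem Q F -> P \in F by exact: mem_rem.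
have [| |P P' /sub PF /sub P'F|F' pF' lF'] := IH (rem Q F).
- by rewrite size_rem//; move: szF; case: (F) F0.
- exact: rem_uniq.
- exact: nest.
exists (Q :: F').
  by rewrite perm_sym (perm_trans pF)// perm_cons perm_sym.
split=> // P; rewrite (perm_mem pF') => PF.
have [[->|QP]|/= QP] := nest Q P QF (sub _ PF); first by right.
- left; have PQ : P `<=` Q by rewrite -QP; exact: subIsetl.
  by rewrite (Qmin _ (sub _ PF) PQ).
- by left; rewrite -QP; exact: subIsetr.
Qed.

Section sparse_families.
Context d (T : measurableType d) (R : realType).
Variable mu : {measure set T -> \bar R}.
Variable S : set (set T).

(** The set E_Q, formed with all smaller cubes of the whole family and not only those of a finite
    subfamily. *)
Definition major_part Q := Q `\` \bigcup_(P in [set P | S P /\ P `<` Q]) P.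

Hypothesis cS : countable S.
Hypothesis mS : forall Q, S Q -> measurable Q /\ (0 < mu Q < +oo)%E.
Hypothesis nestS : forall Q P, S Q -> S P -> [set set0; P; Q] (Q `&` P).
Hypothesis spS : forall Q, S Q ->
  (mu (\bigcup_(P in [set P | S P /\ P `<` Q]) P) <= (2^-1)%:E * mu Q)%E.

Lemma measurable_children Q :
  measurable (\bigcup_(P in [set P | S P /\ P `<` Q]) P).
Proof.
have [P [h [hS _ hsurj]]] := countable_enum cS.
rewrite (_ : \bigcup_(P in _) P =
    \bigcup_(i in [set i | P i /\ h i `<` Q]) h i).
  by apply: bigcup_measurable => i [/hS/mS[]].
apply/seteqP; split=> x [Z].
  by move=> [/hsurj[i Pi <-] iQ] ix; exists i.
by move=> [/hS SZ ZQ] Zx; exists (h Z).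
Qed.

(** Sparseness leaves at least half of the measure of Q in its major part. Of two distinct cubes
    that meet, one is strictly inside the other and is removed from the other's major part, so the
    parts are disjoint. *)
Lemma sparse_list_perm F : uniq F -> (forall Q, Q \in F -> S Q) ->
  exists2 F' : seq (set T), perm_eq F' F & sparse_list mu F' major_part.
Proof.
move=> uF FS; have [|F' pF lF] := leaf_first_perm uF.
  by move=> Q P /FS SQ /FS SP; exact: nestS.
exists F' => //; have F'S Q : Q \in F' -> S Q by rewrite (perm_mem pF) => /FS.
split=> //; first by rewrite (perm_uniq pF).
- move=> Q /F'S SQ; have [mQ m0] := mS SQ; have mC := measurable_children Q.
  have mE : measurable (major_part Q) by exact: measurableD.
  split=> //; first exact: subDsetl.
  have [m0' mf] := andP m0.
  have CQ : \bigcup_(P in [set P | S P /\ P `<` Q]) P `<=` Q.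
    by move=> x [P [_ [PQ _]] Px]; exact: PQ.
  have := spS SQ; rewrite /major_part.
  move: (\bigcup_(P in _) P) mC CQ => C mC CQ CQ2.
  have -> : mu (Q `\` C) = (mu Q - mu C)%E.
    by rewrite measureD// setIidr.
  have Cf : mu C \is a fin_num.
    rewrite ge0_fin_numE// (le_lt_trans CQ2)// lte_mul_pinfty//.
  have Qf : mu Q \is a fin_num by rewrite ge0_fin_numE.
  move: CQ2; rewrite -(fineK Cf) -(fineK Qf) -EFinB -!EFinM !lee_fin => CQ2.
  lra.
- move=> Q P /F'S SQ /F'S SP QP; apply/seteqP; split=> // x [[Qx nQ] [Px nP]].
  have [[QP0|QPP]|QPQ] := nestS SQ SP.
  + by have : (Q `&` P) x by []; rewrite QP0.
  + apply: nQ; exists P => //; split=> //; split; first by rewrite -QPP; exact: subIsetl.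
    move=> PQ; move/eqP: QP; apply; apply/seteqP; split=> //.
    by rewrite -QPP; exact: subIsetl.
  + apply: nP; exists Q => //; split=> //; split; first by rewrite -QPQ; exact: subIsetr.
    move=> PQ; move/eqP: QP; apply; apply/seteqP; split=> //.
    by rewrite -QPQ; exact: subIsetr.
Qed.

End sparse_families.

(** * From finite subfamilies to the whole family *)

Section infinite_operator.
Context d (T : measurableType d) (R : realType).
Variable mu : {measure set T -> \bar R}.
Variable S : set (set T).
Hypothesis cS : countable S.
Hypothesis mS : forall Q, S Q -> measurable Q /\ (0 < mu Q < +oo)%E.
Hypothesis nestS : forall Q P, S Q -> S P -> [set set0; P; Q] (Q `&` P).
Hypothesis spS : forall Q, S Q ->
  (mu (\bigcup_(P in [set P | S P /\ P `<` Q]) P) <= (2^-1)%:E * mu Q)%E.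
Variables (p p' q s W : R) (v : T -> R).
Hypothesis p'E : p' = p / (p - 1).
Hypotheses (p1 : 1 < p) (q1 : 1 < q) (sE : s = q^-1 + p'^-1) (s1 : s < 1).
Hypothesis mins : Num.min (p' / q) (q / p') <= s.
Hypotheses (mv : measurable_fun setT v) (v0 : forall x, 0 < v x).

Local Notation m Q := (fine (mu Q)).
Local Notation int D k := (fine (\int[mu]_(x in D) (k x)%:E)).
Local Notation u := (fun x => v x `^ q).
Local Notation sg := (fun x => v x `^ (- p')).

Hypothesis weightS : forall Q, S Q ->
  [/\ (\int[mu]_(x in Q) (u x)%:E < +oo)%E,
      (\int[mu]_(x in Q) (sg x)%:E < +oo)%E &
      int Q u / m Q * (int Q sg / m Q) `^ (q / p') <= W].

Definition sparse_esum (f : T -> R) (x : T) : \bar R :=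
  \esum_(Q in S) (m Q `^ (- s) * int Q f * \1_Q x)%:E.

Let c (f : T -> R) Q : R := m Q `^ (- s) * int Q f.

Let c_ge0 (f : T -> R) Q : (forall x, 0 <= f x) -> 0 <= c f Q.
Proof. by move=> f0; rewrite mulr_ge0 ?powR_ge0// fine_ge0// integral_nneg. Qed.

Let term_ge0 (f : T -> R) Q x : (forall x, 0 <= f x) ->
  (0 <= (m Q `^ (- s) * int Q f * \1_Q x)%:E)%E.
Proof. by move=> f0; rewrite lee_fin; apply: mulr_ge0 => //; exact: c_ge0. Qed.

Lemma measurable_esum_countable (a : set T -> T -> \bar R) :
  (forall Q x, S Q -> (0 <= a Q x)%E) ->
  (forall Q, S Q -> measurable_fun setT (a Q)) ->
  measurable_fun setT (fun x => \esum_(Q in S) a Q x).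
Proof.
move=> a0 ma; have [P [h hb]] := countable_enum cS; have [hS _ _] := hb.
rewrite (_ : (fun x => _) = fun x => (\sum_(0 <= i <oo | P i) a (h i) x)%E).
  apply: ge0_emeasurable_sum => [i x _ Pi|i Pi]; first by apply: a0; exact: hS.
  by apply: ma; exact: hS.
apply/funext => x; rewrite nneseries_esum; last by move=> i Pi; apply: a0; exact: hS.
exact: reindex_esum.
Qed.

Lemma sparse_esum_bound (f : T -> R) :
  measurable_fun setT f -> (forall x, 0 <= f x) ->
  (\int[mu]_x (f x `^ p * v x `^ p)%:E < +oo)%E ->
  (\int[mu]_x (sparse_esum f x `^ q * (u x)%:E) <=
   ((sparse_const p' q s W *
     fine (\int[mu]_x (f x `^ p * v x `^ p)%:E) `^ p^-1) `^ q)%:E)%E.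
Proof.
move=> mf f0 ff; have [P [h hb]] := countable_enum cS; have [hS hi _] := hb.
have q0 : 0 < q by rewrite (lt_trans _ q1).
pose F N := [seq h i | i <- iota 0 N & P i].
have FS N Q : Q \in F N -> S Q.
  by move=> /mapP[i]; rewrite mem_filter => /andP[Pi _] ->; exact: hS.
have uF N : uniq (F N).
  rewrite map_inj_in_uniq ?filter_uniq ?iota_uniq// => i j.
  rewrite !mem_filter => /andP[Pi _] /andP[Pj _].
  by apply: hi; rewrite inE.
pose t N x := sparse_sum mu (F N) s f x.
have tE N x : (t N x)%:E =
    (\sum_(0 <= i < N | P i) (m (h i) `^ (- s) * int (h i) f * \1_(h i) x)%:E)%E.
  by rewrite /t /sparse_sum big_map big_filter -sumEFin /index_iota subn0.
have bound N : measurable_fun setT (t N) /\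
    (\int[mu]_x (t N x `^ q * u x)%:E <= ((sparse_const p' q s W *
     fine (\int[mu]_x (f x `^ p * v x `^ p)%:E) `^ p^-1) `^ q)%:E)%E.
  (* An initial piece of the enumeration need not be in the order required for Doob's inequality;
     reordering it does not affect the sum. *)
  have [F' pF spF] := sparse_list_perm cS mS nestS spS (uF N) (@FS N).
  have tF' : t N = sparse_sum mu F' s f.
    by apply/funext => x; rewrite /t /sparse_sum; apply/esym/perm_big.
  have wF' Q : Q \in F' -> [/\ (\int[mu]_(x in Q) (u x)%:E < +oo)%E,
      (\int[mu]_(x in Q) (sg x)%:E < +oo)%E &
      int Q u / m Q * (int Q sg / m Q) `^ (q / p') <= W].
    by rewrite (perm_mem pF) => /FS; exact: weightS.
  rewrite tF'; split; first exact: measurable_sparse_sum spF _.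
  exact: (sparse_sum_bound p'E erefl spF p1 q1 sE s1 mins mv v0 wF' mf f0 ff).
pose G N x := (t N x `^ q * u x)%:E.
have t0 N x : 0 <= t N x by exact: sparse_sum_ge0.
have tnd x : {homo (fun N => (t N x)%:E) : N M / (N <= M)%N >-> (N <= M)%E}.
  move=> N M NM; rewrite !tE; apply: ereal_nondecreasing_series NM => i _ _.
  exact: term_ge0.
have mG N : measurable_fun setT (G N).
  apply/measurable_EFinP; apply: measurable_funM; last exact: measurable_powR_comp.
  by apply: measurable_powR_comp; have [] := bound N.
have G0 N x : setT x -> (0 <= G N x)%E.
  by move=> _; rewrite lee_fin mulr_ge0 ?powR_ge0.
have Gnd x : setT x -> {homo G^~ x : N M / (N <= M)%N >-> (N <= M)%E}.
  move=> _ N M /(tnd x); rewrite !lee_fin => NM.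
  by rewrite ler_wpM2r ?powR_ge0// ge0_ler_powR ?nnegrE ?(ltW q0).
(* The power is pulled out of the supremum by inversion: with [y] the supremum of t_N^q u, every t_N
   is at most (y/u)^(1/q), hence so is their supremum. The argument also covers infinite [y]. *)
have SG x : (sparse_esum f x `^ q * (u x)%:E <= limn (G^~ x))%E.
  have -> : limn (G^~ x) = ereal_sup (range (G^~ x)).
    by apply/cvg_lim => //; exact: ereal_nondecreasing_cvgn (Gnd x I).
  set y := ereal_sup _.
  have Gy N : (G N x <= y)%E by apply: ereal_sup_ubound; exists N.
  have y0 : (0 <= y)%E by apply: le_trans (Gy 0%N); exact: G0.
  have -> : sparse_esum f x = ereal_sup (range (fun N => (t N x)%:E)).
    rewrite -(cvg_lim _ (ereal_nondecreasing_cvgn (tnd x)))//.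
    rewrite /sparse_esum (reindex_esum _ _ _ _ hb) -nneseries_esum; last first.
      by move=> i _; exact: term_ge0.
    by congr (limn _); apply/funext => N; rewrite tE.
  have up : 0 < u x by exact: powR_gt0.
  have uV0 : (0 <= ((u x)^-1)%:E)%E by rewrite lee_fin invr_ge0 ltW.
  have ty : (ereal_sup (range (fun N => (t N x)%:E)) <=
      (y * ((u x)^-1)%:E) `^ q^-1)%E.
    apply: ge_ereal_sup => _ [N _ <-].
    have yu : ((t N x `^ q)%:E <= y * ((u x)^-1)%:E)%E.
      have := lee_wpmul2r uV0 (Gy N).
      by rewrite /G EFinM -muleA -[X in (_ * X <= _)%E]EFinM mulfV ?gt_eqF// mule1.
    have -> : (t N x)%:E = ((t N x `^ q)%:E `^ q^-1)%E.
      by rewrite poweR_EFin -powRrM mulfV ?gt_eqF// powRr1.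
    apply: gt0_ler_poweR yu; rewrite ?in_itv/= ?leey ?andbT ?lee_fin ?powR_ge0//.
    - by rewrite invr_ge0 ltW.
    - by rewrite mule_ge0.
  have sup0 : (0 <= ereal_sup (range (fun N => (t N x)%:E)))%E.
    apply: (@le_trans _ _ (t 0%N x)%:E); first by rewrite lee_fin.
    by apply: ereal_sup_ubound; exists 0%N.
  have yu0 : (0 <= y * ((u x)^-1)%:E)%E by rewrite mule_ge0.
  have {}ty : (ereal_sup (range (fun N => (t N x)%:E)) `^ q <=
      y * ((u x)^-1)%:E)%E.
    have -> : (y * ((u x)^-1)%:E = ((y * ((u x)^-1)%:E) `^ q^-1) `^ q)%E.
      by rewrite -poweRrM mulVf ?gt_eqF// poweRe1.
    apply: gt0_ler_poweR ty; rewrite ?in_itv/= ?leey ?andbT ?poweR_ge0//.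
    exact: ltW.
  have ux0 : (0 <= (u x)%:E)%E by rewrite lee_fin ltW.
  have := lee_wpmul2r ux0 ty.
  by rewrite -[X in (_ <= X)%E]muleA -EFinM mulVf ?gt_eqF// mule1.
have mE : measurable_fun setT (fun x => sparse_esum f x).
  apply: measurable_esum_countable => [Q x _|Q SQ]; first exact: term_ge0.
  apply/measurable_EFinP; apply: measurable_funM => //.
  by apply: measurable_indic; have [] := mS SQ.
have mu_ : measurable_fun setT (fun x => (u x)%:E).
  by apply/measurable_EFinP; exact: measurable_powR_comp.
apply: (@le_trans _ _ (\int[mu]_x limn (G^~ x))%E).
  apply: ge0_le_integral => //.
  - by move=> x _; rewrite mule_ge0 ?poweR_ge0// lee_fin powR_ge0.
  - apply: emeasurable_funM => //.
    exact: (measurableT_comp (measurable_poweR q) mE).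
  - apply: emeasurable_fun_cvg mG _ => x _.
    by apply: ereal_nondecreasing_is_cvgn; exact: Gnd.
have cv := @cvg_monotone_convergence _ _ _ mu _ measurableT _ mG G0 Gnd.
rewrite -(cvg_lim _ cv)//; apply: lime_le; first by apply/cvg_ex; eexists; exact: cv.
by apply: nearW => N; have [] := bound N.
Qed.

End infinite_operator.

(** * Weights and dyadic cubes in Euclidean space *)

Section weighted_integrals.
Context d (T : measurableType d) (R : realType).

Lemma measurable_poweR_comp (f : T -> \bar R) (r : R) :
  measurable_fun setT f -> measurable_fun setT (fun x => f x `^ r)%E.
Proof. by move=> mf; exact: (measurableT_comp (measurable_poweR r) mf). Qed.

Lemma measurable_abse_comp (f : T -> \bar R) :
  measurable_fun setT f -> measurable_fun setT (fun x => `|f x|)%E.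
Proof. by move=> mf; exact: (measurableT_comp (@abse_measurable R setT) mf). Qed.

Variable mu : {measure set T -> \bar R}.

(* Cauchy-Schwarz for [1 = k^(1/2) (1/k)^(1/2)]. *)
Lemma integral_gt0 (Q : set T) (k : T -> R) : measurable Q -> (0 < mu Q)%E ->
  measurable_fun setT k -> (forall x, 0 < k x) ->
  (0 < \int[mu]_(x in Q) (k x)%:E)%E.
Proof.
move=> mQ Q0 mk k0.
have k0' x : 0 <= k x by exact: ltW.
have h0 : (0 : R) < 2^-1 by rewrite invr_gt0.
have h1 : (2^-1 : R) < 1 by rewrite invf_lt1// ltr1n.
have kV0 x : 0 <= k x `^ (-1) by exact: powR_ge0.
have := integral_interpolation mu mQ mk (measurable_powR_comp (-1) mk) k0' kV0 h0 h1.
have hh : (1 : R) - 2^-1 = 2^-1 by field.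
under eq_integral => x _.
  rewrite hh -powRM// -{1}(powRr1 (k0' x)) -powRD; last first.
    by rewrite (gt_eqF (k0 x)) implybT.
  rewrite addrN powRr0 powR1; over.
have := integral_cst mu mQ 1%E; rewrite mul1e => ->.
move=> muQ; rewrite lt_neqAle integral_nneg// andbT.
apply: contraTneq (lt_le_trans Q0 muQ) => <-.
by rewrite poweR0r ?gt_eqF// mul0e ltxx.
Qed.

(** Where |f| = +oo and w > 0 the integrand is +oo, which happens only on a null set because the
    integral is finite. *)
Lemma ae_fine_of_weight (f w : T -> \bar R) (p : R) : 0 < p ->
  measurable_fun setT f -> measurable_fun setT w ->
  {ae mu, forall x, (0 < w x < +oo)%E} ->
  (\int[mu]_x (`|f x| `^ p * w x `^ p) < +oo)%E ->
  {ae mu, forall x, `|f x|%E = (fine `|f x|%E)%:E}.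
Proof.
move=> p0 mf mw w0 fi.
have mg : measurable_fun setT (fun x => `|f x| `^ p * w x `^ p)%E.
  apply: emeasurable_funM; apply: measurable_poweR_comp => //.
  exact: measurable_abse_comp.
have ig : mu.-integrable setT (fun x => `|f x| `^ p * w x `^ p)%E.
  apply/integrableP; split=> //.
  under eq_integral do rewrite gee0_abs ?mule_ge0 ?poweR_ge0//.
  exact: fi.
apply: filterS2 (integrable_ae measurableT ig) w0 => x /(_ I) gx /andP[wx wy].
apply/esym/fineK; rewrite ge0_fin_numE// ltey.
apply: contraTneq gx => ->.
rewrite poweRyr ?gt_eqF// gt0_mulye//; exact: poweR_gt0.
Qed.

End weighted_integrals.

Section euclidean.
Context (R : realType) (n : nat).
Implicit Types (Q : set (Rn R n)) (D S : set (set (Rn R n))).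
Local Notation mu := (@lebesgue R n).
Local Notation m Q := (fine (mu Q)).

Lemma is_cube_measure Q : is_cube Q -> measurable Q /\ (0 < mu Q < +oo)%E.
Proof.
move=> [a [l [bl [br [l0 ->]]]]]; have [mQ ->] := lebesgue_cube a bl br l0.
by split=> //; rewrite lte_fin exprn_gt0//= ltry.
Qed.

Lemma is_cube_rat_point Q : is_cube Q ->
  exists r : {ffun 'I_n -> rat}, Q [tuple ratr (r i) | i < n].
Proof.
move=> [a [l [bl [br [l0 ->]]]]].
have /choice[r Hr] i : exists r : rat, ratr r \in `]a i, (a i + l)[.
  by apply: rat_in_itvoo; rewrite ltrDl.
exists [ffun i => r i] => i; rewrite /Rn_coord tnth_mktuple ffunE.
have := Hr i; apply: subitvP; rewrite subitvE !bnd_simp/=.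
by case: (bl i); case: (br i).
Qed.

(* A dyadic cube is determined by its generation and any of its points, in
   particular by a rational one. *)
Lemma countable_dyadic_grid D : is_dyadic_grid D -> countable D.
Proof.
move=> [cubes sizes _ parts].
pose code Q (z : int * {ffun 'I_n -> rat}) :=
  mu Q = (2 ^ (n%:Z * z.1))%R%:E /\ Q [tuple ratr (z.2 i) | i < n].
have codeP Q : exists z, D Q -> code Q z.
  have [DQ|nDQ] := pselect (D Q); last by exists (0, [ffun=> 0]).
  have [k kQ] := sizes _ DQ; have [r rQ] := is_cube_rat_point (cubes _ DQ).
  by exists (k, r).
have [c cP] := choice codeP.
apply/countable_injP; exists (fun Q => pickle (c Q)) => Q P.
rewrite !inE => DQ DP /(pcan_inj pickleK) cQP.
have [kQ pQ] := cP _ DQ; have [kP pP] := cP _ DP; rewrite -cQP in kP pP.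
have [_ triv _] := parts (c Q).1.
apply: triv => //; by exists [tuple ratr ((c Q).2 i) | i < n].
Qed.

End euclidean.

Section weights.
Context d (T : measurableType d) (R : realType).
Variable mu : {measure set T -> \bar R}.

Lemma weight_real_version (w : T -> \bar R) : measurable_fun setT w ->
  {ae mu, forall x, (0 < w x < +oo)%E} ->
  exists v : T -> R, [/\ measurable_fun setT v, forall x, 0 < v x &
    {ae mu, forall x, w x = (v x)%:E}].
Proof.
move=> mw w0; pose A := w @^-1` [set` `]0%E, +oo%E[].
have mA : measurable A.
  by rewrite -[A]setTI; apply: mw => //; exact: emeasurable_itv.
have AE x : A x = (0 < w x < +oo)%E by rewrite /A/= in_itv.
have mfw : measurable_fun setT (fun x => fine (w x)).
  exact: (measurableT_comp (fine_measurable measurableT) mw).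
(* The value 1 outside [A] keeps [v] positive everywhere, so that identities between its powers hold
   at every point and not merely almost everywhere. *)
exists (fun x => fine (w x) * \1_A x + \1_(~` A) x); split.
- apply: measurable_funD; last by apply: measurable_indic; exact: measurableC.
  by apply: measurable_funM => //; exact: measurable_indic.
- move=> x; rewrite !indicE in_setC; have [/set_mem Ax|_] := boolP (x \in A).
    by rewrite mulr1 addr0 fine_gt0// -AE.
  by rewrite mulr0 add0r.
- apply: filterS w0 => x wx; have Ax : A x by rewrite AE.
  rewrite !indicE in_setC mem_set//= mulr1 addr0 fineK//.
  by have /andP[w0 wy] := wx; rewrite ge0_fin_numE// ltW.
Qed.

Lemma ae_eq_integral_poweR (w : T -> \bar R) (v : T -> R) (r : R) (Q : set T) :
  measurable Q -> measurable_fun setT w -> measurable_fun setT v ->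
  {ae mu, forall x, w x = (v x)%:E} ->
  (\int[mu]_(x in Q) (w x `^ r) = \int[mu]_(x in Q) (v x `^ r)%:E)%E.
Proof.
move=> mQ mw mv wv; apply: ge0_ae_eq_integral => //.
- apply: measurable_funTS; exact: measurable_poweR_comp.
- apply: measurable_funTS; apply/measurable_EFinP; exact: measurable_powR_comp.
- by move=> x _; exact: poweR_ge0.
- by move=> x _; rewrite lee_fin powR_ge0.
- by apply: filterS wv => x -> _; rewrite poweR_EFin.
Qed.

(** Both integrals are strictly positive, so if either were infinite the product would be +oo and
    could not be bounded by [W]. *)
Lemma muckenhoupt_finite (Q : set T) (u sg : T -> R) (r W : R) :
  measurable Q -> (0 < mu Q < +oo)%E ->
  measurable_fun setT u -> measurable_fun setT sg ->
  (forall x, 0 < u x) -> (forall x, 0 < sg x) -> 0 < r ->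
  ((fine (mu Q))^-1%:E * \int[mu]_(x in Q) (u x)%:E *
   ((fine (mu Q))^-1%:E * \int[mu]_(x in Q) (sg x)%:E) `^ r <= W%:E)%E ->
  [/\ (\int[mu]_(x in Q) (u x)%:E < +oo)%E,
      (\int[mu]_(x in Q) (sg x)%:E < +oo)%E &
      fine (\int[mu]_(x in Q) (u x)%:E) / fine (mu Q) *
      (fine (\int[mu]_(x in Q) (sg x)%:E) / fine (mu Q)) `^ r <= W].
Proof.
move=> mQ /andP[Q0 Qf] mu_ msg u0 sg0 r0.
have := integral_gt0 mQ Q0 mu_ u0; have := integral_gt0 mQ Q0 msg sg0.
have m0 : 0 < (fine (mu Q))^-1 by rewrite invr_gt0 fine_gt0// Q0.
move: ((fine (mu Q))^-1) m0 => k k0.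
case: (\int[mu]_(x in Q) (sg x)%:E)%E => [S||//];
case: (\int[mu]_(x in Q) (u x)%:E)%E => [U||//] /=; rewrite ?lte_fin => S0 U0.
- by rewrite -!EFinM lee_fin !ltry ![_ * k]mulrC.
- rewrite gt0_muley ?lte_fin// gt0_mulye//.
  by rewrite lte_fin powR_gt0// mulr_gt0.
- rewrite gt0_muley ?lte_fin// poweRyr ?gt_eqF// gt0_muley//.
  by rewrite -EFinM lte_fin mulr_gt0.
- by rewrite gt0_muley ?lte_fin// poweRyr ?gt_eqF// gt0_muley.
Qed.

End weights.

(** * Replacing an extended-valued f by a finite version of |f| *)

Section weighted_norms.
Context d (T : measurableType d) (R : realType).
Variable mu : {measure set T -> \bar R}.
Variables (p q : R) (w f : T -> \bar R) (v : T -> R).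
Hypotheses (p1 : 1 < p) (q0 : 0 < q).
Hypotheses (mw : measurable_fun setT w) (mv : measurable_fun setT v).
Hypotheses (v0 : forall x, 0 < v x) (wv : {ae mu, forall x, w x = (v x)%:E}).
Hypothesis mf : measurable_fun setT f.
Hypothesis fp_fin : (\int[mu]_x (`|f x| `^ p * w x `^ p) < +oo)%E.
Let f0 x : R := fine (`|f x|)%E.

Let p0 : 0 < p. Proof. exact: lt_trans ltr01 p1. Qed.

Lemma measurable_fine_abse : measurable_fun setT f0.
Proof.
exact: (measurableT_comp (fine_measurable measurableT) (measurable_abse_comp mf)).
Qed.

Let f00 x : 0 <= f0 x. Proof. by rewrite fine_ge0. Qed.

Let f_ae : {ae mu, forall x, `|f x|%E = (f0 x)%:E}.
Proof.
apply: (ae_fine_of_weight p0 mf mw _ fp_fin).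
by apply: filterS wv => x ->; rewrite lte_fin v0 ltry.
Qed.

Lemma weighted_integral_fine : (\int[mu]_x (`|f x| `^ p * w x `^ p) =
  \int[mu]_x (f0 x `^ p * v x `^ p)%:E)%E.
Proof.
have mf0 := measurable_fine_abse.
apply: ge0_ae_eq_integral => //.
- exact: emeasurable_funM (measurable_poweR_comp _ (measurable_abse_comp mf))
    (measurable_poweR_comp _ mw).
- apply/measurable_EFinP; apply: measurable_funM; exact: measurable_powR_comp.
- by move=> x _; rewrite mule_ge0 ?poweR_ge0.
- by move=> x _; rewrite lee_fin mulr_ge0 ?powR_ge0.
- by apply: filterS2 f_ae wv => x -> -> _; rewrite !poweR_EFin EFinM.
Qed.

(** Local integrability of [f] by Hoelder's inequality, applied to |f| = (|f|^p v^p)^(1/p)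
    (v^(-p'))^(1/p') with p' = p/(p - 1). *)
Lemma integral_fine_lty Q : measurable Q ->
  (\int[mu]_(x in Q) (v x `^ (- (p / (p - 1))))%:E < +oo)%E ->
  (\int[mu]_(x in Q) (f0 x)%:E < +oo)%E.
Proof.
move=> mQ sf; have mf0 := measurable_fine_abse.
have pi0 : 0 < p^-1 by rewrite invr_gt0.
have pi1 : p^-1 < 1 by rewrite invf_lt1.
have m1 : measurable_fun setT (fun x => f0 x `^ p * v x `^ p).
  by apply: measurable_funM; exact: measurable_powR_comp.
have p1' x : 0 <= f0 x `^ p * v x `^ p by rewrite mulr_ge0 ?powR_ge0.
have p2' x : 0 <= v x `^ (- (p / (p - 1))) by exact: powR_ge0.
have := fp_fin; rewrite weighted_integral_fine => fin1.
have fin2 := integral_subset_lty mQ measurableT m1 p1' (@subsetT _ _) fin1.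
have [|//] := @fine_integral_interpolation _ _ _ mu Q f0 _ _ p^-1 mQ m1
  (measurable_powR_comp (- (p / (p - 1))) mv) p1' p2' pi0 pi1 _ fin2 sf.
move=> x; have vx := ltW (v0 x).
rewrite powRM ?powR_ge0// -!powRrM mulfV ?gt_eqF//.
have -> : - (p / (p - 1)) * (1 - p^-1) = -1.
  by field; rewrite !gt_eqF// subr_gt0.
rewrite (powRr1 vx) (powRr1 (f00 x)) powR_inv1//.
by rewrite -mulrA mulfV ?mulr1// gt_eqF.
Qed.

Lemma abse_integral_le_fine Q : measurable Q ->
  (\int[mu]_(x in Q) (f0 x)%:E < +oo)%E ->
  (`|\int[mu]_(x in Q) f x| <= (fine (\int[mu]_(x in Q) (f0 x)%:E))%:E)%E.
Proof.
move=> mQ If; rewrite ge0_fine_EFin; last by rewrite integral_nneg.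
apply: le_trans (le_abse_integral _ mQ _) _; first exact: measurable_funTS.
rewrite le_eqVlt; apply/orP; left; apply/eqP.
apply: ge0_ae_eq_integral => //.
- by apply: measurable_funTS; exact: measurable_abse_comp.
- by apply: measurable_funTS; apply/measurable_EFinP; exact: measurable_fine_abse.
- by move=> y _; rewrite lee_fin.
- by apply: filterS f_ae => y -> _.
Qed.

Lemma weighted_norm_le (g h : T -> \bar R) (K : R) : 0 <= K ->
  measurable_fun setT g -> measurable_fun setT h ->
  (forall x, `|g x| <= h x)%E ->
  (\int[mu]_x (h x `^ q * (v x `^ q)%:E) <=
   ((K * fine (\int[mu]_x (f0 x `^ p * v x `^ p)%:E) `^ p^-1) `^ q)%:E)%E ->
  ((\int[mu]_x (`|g x| `^ q * w x `^ q)) `^ q^-1 <=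
   K%:E * (\int[mu]_x (`|f x| `^ p * w x `^ p)) `^ p^-1)%E.
Proof.
move=> K0 mg mh gh HK.
have h0 x : (0 <= h x)%E by exact: le_trans (gh x).
have le1 : (\int[mu]_x (`|g x| `^ q * w x `^ q) <=
    \int[mu]_x (h x `^ q * (v x `^ q)%:E))%E.
  apply: ae_ge0_le_integral => //.
  - by move=> x _; rewrite mule_ge0 ?poweR_ge0.
  - exact: emeasurable_funM (measurable_poweR_comp _ (measurable_abse_comp mg))
      (measurable_poweR_comp _ mw).
  - by move=> x _; rewrite mule_ge0 ?poweR_ge0// lee_fin powR_ge0.
  - apply: emeasurable_funM; first exact: measurable_poweR_comp mh.
    by apply/measurable_EFinP; exact: measurable_powR_comp.
  - apply: filterS wv => x -> _; rewrite poweR_EFin; apply: lee_wpmul2r.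
      by rewrite lee_fin powR_ge0.
    by apply: gt0_ler_poweR (gh x); rewrite ?in_itv/= ?leey ?andbT// ltW.
have qi0 : 0 <= q^-1 by rewrite invr_ge0 ltW.
rewrite weighted_integral_fine.
have fin : (0 <= \int[mu]_x (f0 x `^ p * v x `^ p)%:E < +oo)%E.
  rewrite -weighted_integral_fine fp_fin andbT.
  by apply: integral_ge0 => x _; rewrite mule_ge0 ?poweR_ge0.
rewrite -(ge0_fine_EFin fin) poweR_EFin -EFinM.
have := le_trans le1 HK.
have : 0 <= K * fine (\int[mu]_x (f0 x `^ p * v x `^ p)%:E) `^ p^-1.
  by rewrite mulr_ge0 ?powR_ge0.
move: (fine _ `^ p^-1) => A KA0 le3.
have -> : (K * A)%:E = (((K * A) `^ q)%:E `^ q^-1)%E.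
  by rewrite poweR_EFin -powRrM mulfV ?gt_eqF// powRr1.
apply: gt0_ler_poweR le3; rewrite ?in_itv/= ?leey ?andbT ?lee_fin ?powR_ge0//.
by apply: integral_ge0 => x _; rewrite mule_ge0 ?poweR_ge0.
Qed.

End weighted_norms.

(** * Pointwise domination of the operator by its action on |f| *)

Lemma measurable_esum_funepos d (T : measurableType d) (R : realType)
    (S : set (set T)) (a : set T -> T -> \bar R) : countable S ->
  (forall Q, S Q -> measurable_fun setT (a Q)) ->
  measurable_fun setT (fun x =>
    (\esum_(Q in S) (a ^~ x)^\+ Q - \esum_(Q in S) (a ^~ x)^\- Q)%E).
Proof.
move=> cS ma; apply: emeasurable_funB.
- apply: (measurable_esum_countable cS) => [Q x _|Q SQ]; first exact: funepos_ge0.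
  under eq_fun do rewrite funeposE.
  by apply: measurable_maxe; [exact: ma | exact: measurable_cst].
- apply: (measurable_esum_countable cS) => [Q x _|Q SQ]; first exact: funeneg_ge0.
  under eq_fun do rewrite funenegE.
  apply: measurable_maxe; last exact: measurable_cst.
  exact: (measurableT_comp (@oppe_measurable R setT) (ma Q SQ)).
Qed.

Lemma measurable_sparse_esum d (T : measurableType d) (R : realType)
    (mu : {measure set T -> \bar R}) (S : set (set T)) (s : R) (f : T -> R) :
  countable S -> (forall Q, S Q -> measurable Q) -> (forall x, 0 <= f x) ->
  measurable_fun setT (sparse_esum mu S s f).
Proof.
move=> cS mS f0; apply: (measurable_esum_countable cS) => [Q x _|Q SQ].
  by rewrite lee_fin !mulr_ge0 ?powR_ge0// fine_ge0// integral_nneg.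
apply/measurable_EFinP; apply: measurable_funM => //.
by apply: measurable_indic; exact: mS.
Qed.

(** The triangle inequality for the positive and negative parts, whose sums add up to the sum of
    |a|. It remains true in the case +oo - +oo, because the right side is then +oo as well. *)
Lemma abse_esum_funepos (R : realType) (X : choiceType) (S : set X)
    (a : X -> \bar R) (b : X -> \bar R) :
  (forall i, S i -> `|a i| <= b i)%E ->
  (`|\esum_(i in S) a^\+ i - \esum_(i in S) a^\- i| <= \esum_(i in S) b i)%E.
Proof.
move=> ab; apply: le_trans (lee_abs_sub _ _) _.
have pos0 : (0 <= \esum_(i in S) a^\+ i)%E.
  by apply: esum_ge0 => i _; exact: funepos_ge0.
have neg0 : (0 <= \esum_(i in S) a^\- i)%E.
  by apply: esum_ge0 => i _; exact: funeneg_ge0.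
rewrite !gee0_abs// -esumD => [|i _|i _]; [|exact: funepos_ge0|exact: funeneg_ge0].
apply: le_esum => i Si; have := ab _ Si.
by have /(congr1 (fun g => g i)) /= -> := fune_abse a.
Qed.

Lemma abs_average_term (R : realType) (m e s I0 : R) (I : \bar R) :
  0 < m -> - s = e - 1 -> (`|I| <= I0%:E)%E -> forall k : R, 0 <= k ->
  (`|(m `^ e)%:E * (m^-1%:E * I) * k%:E| <= (m `^ (- s) * I0 * k)%:E)%E.
Proof.
move=> m0 -> II0 k k0; rewrite !abseM !abse_EFin.
rewrite !ger0_norm ?powR_ge0 ?invr_ge0 ?(ltW m0)//.
rewrite powRD ?(gt_eqF m0) ?implybT// powR_inv1 ?(ltW m0)//.
rewrite EFinM; apply: lee_wpmul2r; first by rewrite lee_fin.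
rewrite -[X in (_ <= X%:E)%E]mulrA EFinM; apply: lee_wpmul2l.
  by rewrite lee_fin powR_ge0.
by rewrite EFinM; apply: lee_wpmul2l; rewrite // lee_fin invr_ge0 ltW.
Qed.

(** Passage from nonnegative real functions to signed extended-valued ones. Each cube average of [f]
    is dominated by that of |f|, so the signed operator is bounded pointwise by the sum over [S] for
    |f|; the assumed estimate for the latter makes [K] an admissible constant in the operator
    norm. *)
Lemma sparse_frac_bound (R : realType) (n : nat) (S : set (set (Rn R n)))
    (alpha p q K : R) (w : Rn R n -> \bar R) (v : Rn R n -> R) :
  countable S -> (forall Q, S Q -> is_cube Q) -> 1 < p -> 0 < q -> 0 <= K ->
  measurable_fun setT w -> measurable_fun setT v -> (forall x, 0 < v x) ->
  {ae @lebesgue R n, forall x, w x = (v x)%:E} ->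
  (forall Q, S Q ->
    (\int[@lebesgue R n]_(x in Q) (v x `^ (- conj_exp p))%:E < +oo)%E) ->
  (forall f : Rn R n -> R, measurable_fun setT f -> (forall x, (0 <= f x)%R) ->
    (\int[@lebesgue R n]_x (f x `^ p * v x `^ p)%:E < +oo)%E ->
    (\int[@lebesgue R n]_x
       (sparse_esum (@lebesgue R n) S (1 - alpha / n%:R) f x `^ q *
        (v x `^ q)%:E) <=
     ((K * fine (\int[@lebesgue R n]_x (f x `^ p * v x `^ p)%:E) `^ p^-1)
       `^ q)%:E)%E) ->
  (op_norm p (fun x => w x `^ p) q (fun x => w x `^ q) (sparse_frac S alpha)
     <= K%:E)%E.
Proof.
move=> cS cubeS p1 q0 K0 mw mv v0 wv sgf HK.
apply: ereal_inf_lbound; exists K; last exact: erefl.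
split; first exact: K0.
move=> f [mf Nf]; have p0 : 0 < p := lt_trans ltr01 p1.
have fp : (\int[@lebesgue R n]_x (`|f x| `^ p * w x `^ p) < +oo)%E.
  apply: lty_poweRy Nf; by rewrite invr_eq0 gt_eqF.
pose f0 x : R := fine (`|f x|)%E.
have f00 x : 0 <= f0 x by rewrite fine_ge0.
have mf0 : measurable_fun setT f0 by exact: measurable_fine_abse mf.
have wi := weighted_integral_fine p1 mw mv v0 wv mf fp.
have f0p : (\int[@lebesgue R n]_x (f0 x `^ p * v x `^ p)%:E < +oo)%E.
  by rewrite -wi.
have mT : measurable_fun setT (sparse_frac S alpha f).
  apply: (measurable_esum_funepos (a := fun Q x => sparse_term alpha f x Q) cS).
  move=> Q /cubeS/is_cube_measure[mQ _].
  by apply: measurable_funeM; apply/measurable_EFinP; exact: measurable_indic mQ.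
have mS Q : S Q -> measurable Q by move=> /cubeS/is_cube_measure[].
have mE := measurable_sparse_esum (@lebesgue R n) (1 - alpha / n%:R) cS mS f00.
have TE x : (`|sparse_frac S alpha f x| <=
    sparse_esum (@lebesgue R n) S (1 - alpha / n%:R) f0 x)%E.
  apply: (abse_esum_funepos (a := sparse_term alpha f x)) => Q SQ.
  have [mQ mQ0] := is_cube_measure (cubeS _ SQ).
  have m0 : 0 < fine (@lebesgue R n Q) by rewrite fine_gt0.
  have mQE : @lebesgue R n Q = (fine (@lebesgue R n Q))%:E.
    by rewrite ge0_fine_EFin//; case/andP: mQ0 => /ltW ->.
  have If := integral_fine_lty p1 mw mv v0 wv mf fp mQ (sgf _ SQ).
  have aE := abse_integral_le_fine p1 mw v0 wv mf fp mQ If.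
  rewrite /sparse_term /avg [X in (X `^ _)%E]mQE poweR_EFin.
  apply: abs_average_term m0 _ aE _ _; last by rewrite indicE.
  by rewrite opprB addrC.
have le1 := weighted_norm_le p1 q0 mw mv v0 wv mf fp K0 mT mE TE (HK _ mf0 f00 f0p).
split; last exact: le1.
split; first exact: mT.
apply: le_lt_trans le1 _; apply: lte_mul_pinfty; last exact: Nf.
  by rewrite lee_fin.
by [].
Qed.

Unset Implicit Arguments.

Theorem theorem3p2 (R : realType) (n : nat)
    (D S : set (set (Rn R n))) (alpha p q : R) (w : Rn R n -> \bar R) :
  is_dyadic_grid D -> S `<=` D -> is_sparse S ->
  0 < alpha -> alpha < n%:R -> 1 < p -> p < n%:R / alpha ->
  q^-1 = p^-1 - alpha / n%:R ->
  let p' := conj_exp p in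
  Num.min (p' / q) (q / p') <= 1 - alpha / n%:R ->
  is_Apq p q w ->
  let c := p' * (1 + q / p') `^ (1 - alpha / n%:R) *
           2 `^ ((1 - alpha / n%:R) * Num.max (q / p') (p' / q)) in
  (op_norm p (fun x => w x `^ p) q (fun x => w x `^ q) (sparse_frac S alpha)
     <= c%:E *
        Apq_const p q w `^ ((1 - alpha / n%:R) * Num.max 1 (p' / q))%R)%E.
Proof.
move=> gridD SD spS a0 an p1 pa qE p' mins [[mw w0] Wfin]; cbv zeta.
have [cubes _ nest _] := gridD.
have n0 : 0 < n%:R :> R by exact: lt_trans an.
have p0 : 0 < p by exact: lt_trans p1.
have pm : 0 < p - 1 by rewrite subr_gt0.
have p'0 : 0 < p' by rewrite divr_gt0.
have an0 : 0 < alpha / n%:R by rewrite divr_gt0.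
(* This is the role of p < n / alpha: it says alpha / n < 1/p. *)
have qV0 : 0 < q^-1.
  rewrite qE subr_gt0 -[ltLHS]invf_div ltf_pV2// ?posrE//.
  exact: divr_gt0.
have q0 : 0 < q by rewrite -invr_gt0.
have q1 : 1 < q.
  rewrite -ltf_pV2 ?posrE// invr1 qE (le_lt_trans _ (_ : p^-1 < 1))//.
    by rewrite gerBl ltW.
  by rewrite invf_lt1.
have p'V : p'^-1 = 1 - p^-1 by rewrite /p' /conj_exp; field; rewrite !gt_eqF.
have sE : 1 - alpha / n%:R = q^-1 + p'^-1 by rewrite qE p'V; ring.
have s1 : 1 - alpha / n%:R < 1 by rewrite ltrBlDr ltrDl.
have cubeS Q : S Q -> is_cube Q by move=> /SD/cubes.
have cS : countable S.
  exact: sub_countable (subset_card_le SD) (countable_dyadic_grid gridD).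
have mS Q (SQ : S Q) := is_cube_measure (cubeS Q SQ).
have nestS Q P : S Q -> S P -> [set set0; P; Q] (Q `&` P).
  by move=> /SD DQ /SD; exact: nest.
have [v [mv v0 wv]] := weight_real_version mw w0.
set W := fine (Apq_const p q w).
have Apq_le Q : is_cube Q -> (avg Q (fun x => w x `^ q) *
    avg Q (fun x => w x `^ (- p')) `^ (q / p') <= Apq_const p q w)%E.
  by move=> cQ; apply: ereal_sup_ubound; exists Q.
(* A supremum over no cubes would be -oo; the half-open unit cube is a witness that there is one,
   and its product of averages is nonnegative. *)
have W0 : (0 <= Apq_const p q w)%E.
  have cQ : is_cube [set x : Rn R n | forall i, Rn_coord x i \in
      Interval (BSide true 0) (BSide true (0 + 1))].
    by exists (fun=> 0), 1, (fun=> true), (fun=> true); split.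
  apply: le_trans (Apq_le _ cQ); apply: mule_ge0; last exact: poweR_ge0.
  apply: mule_ge0; first by rewrite lee_fin invr_ge0 fine_ge0.
  by apply: integral_ge0 => x _; exact: poweR_ge0.
have WE : Apq_const p q w = W%:E by rewrite /W ge0_fine_EFin// W0.
have weightS Q : S Q ->
  [/\ (\int[@lebesgue R n]_(x in Q) (v x `^ q)%:E < +oo)%E,
      (\int[@lebesgue R n]_(x in Q) (v x `^ (- p'))%:E < +oo)%E &
      fine (\int[@lebesgue R n]_(x in Q) (v x `^ q)%:E) / fine (@lebesgue R n Q) *
      (fine (\int[@lebesgue R n]_(x in Q) (v x `^ (- p'))%:E) /
       fine (@lebesgue R n Q)) `^ (q / p') <= W].
  move=> SQ; have [mQ mQ0] := mS Q SQ.
  have qp0 : 0 < q / p' by rewrite divr_gt0.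
  have up x : 0 < v x `^ q by exact: powR_gt0.
  have sp x : 0 < v x `^ (- p') by exact: powR_gt0.
  apply: (muckenhoupt_finite mQ mQ0 (measurable_powR_comp q mv)
    (measurable_powR_comp (- p') mv) up sp qp0).
  have := Apq_le Q (cubeS Q SQ); rewrite WE /avg.
  by rewrite (ae_eq_integral_poweR q mQ mw mv wv)
    (ae_eq_integral_poweR (- p') mQ mw mv wv).
rewrite WE poweR_EFin -EFinM.
apply: (sparse_frac_bound cS cubeS p1 q0 _ mw mv v0 wv).
- by do 3 (apply: mulr_ge0; last exact: powR_ge0); exact: ltW.
- by move=> Q /weightS[].
- move=> f mf f0 ff.
  exact: (sparse_esum_bound cS mS nestS spS erefl p1 q1 sE s1 mins mv v0 weightS
    mf f0 ff).
Qed.
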